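(* The product $I_{\nu}(x)K_{\nu}(x)$ can be bounded by $$F_{-1}^{(p,q)}(\nu,x)<I_{\nu}(x)K_{\nu}(x)<F_{+1}^{(p,q)}(\nu,x),\qquad x>0,$$ where the lower bounds hold for $\nu\ge \nu_L^{(p,q)}$ and the upper bounds hold for $\nu\ge \nu_U^{(p,q)}$, for the following sets of functions and ranges. 1. $F_{\lambda}^{(0,1)}(\nu,x)=\dfrac{1}{\sqrt{\nu^2+x^2}+\sqrt{(\nu-\lambda)^2+x^2}-\lambda}$, $\nu_L^{(0,1)}=-1$, $\nu_U^{(0,1)}=0$. 2. $F_{\lambda}^{(1,0)}(\nu,x)=\dfrac{1}{2\sqrt{\nu^2+\frac{\nu}{\nu+\lambda}x^2}}$, $\nu_L^{(1,0)}=1$, $\nu_U^{(1,0)}=0$. 3. $F_{\lambda}^{(0,2)}(\nu,x)=\dfrac{1}{2\sqrt{(\nu-\lambda/2)^2+x^2}}$, $\nu_L^{(0,2)}=-\frac12$, $\nu_U^{(0,2)}=\frac12$. 4. $F_{\lambda}^{(1,1)}(\nu,x)=\dfrac{1}{\sqrt{\nu^2+x^2}+\sqrt{(\nu+\lambda)^2+x^2}-\lambda}$, $\nu_L^{(1,1)}=0$, $\nu_U^{(1,1)}=-1$. 5. $F_{\lambda}^{(2,0)}(\nu,x)=\dfrac{1}{\sqrt{(\nu-2\lambda)^2+\frac{\nu-2\lambda}{\nu-\lambda}x^2}+\sqrt{\nu^2+\frac{\nu}{\nu+\lambda}x^2}+2\lambda}$, $\nu_L^{(2,0)}=1$, $\nu_U^{(2,0)}=2$.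 6. $F_{\lambda}^{(1,2)}(\nu,x)=\dfrac{1}{\nu+\frac{\lambda}{2}+\sqrt{(\nu-\frac{\lambda}{2})^2+x^2}+\dfrac{x^2}{\nu+\frac{\lambda}{2}+\sqrt{(\nu+\frac{3\lambda}{2})^2+x^2}}}$, $\nu_L^{(1,2)}=\frac32$, $\nu_U^{(1,2)}=\frac12$. 7. $F_{\lambda}^{(2,1)}(\nu,x)=\dfrac{1}{\nu-\lambda+\sqrt{(\nu+\lambda)^2+x^2}+\dfrac{x^2}{\nu-\lambda+\sqrt{(\nu-2\lambda)^2+x^2}}}$, $\nu_L^{(2,1)}=-1$, $\nu_U^{(2,1)}=0$. 8. $F_{\lambda}^{(3,0)}(\nu,x)=\dfrac{1}{\nu+2\lambda+\sqrt{(\nu-2\lambda)^2+\frac{\nu-2\lambda}{\nu-\lambda}x^2}+\dfrac{x^2}{\nu+\lambda+\sqrt{(\nu+3\lambda)^2+\frac{\nu+3\lambda}{\nu+2\lambda}x^2}}}$, $\nu_L^{(3,0)}=3$, $\nu_U^{(3,0)}=2$. 9. $F_{\lambda}^{(0,3)}(\nu,x)=\dfrac{1}{\nu-\frac{\lambda}{2}+\sqrt{\nu^2-\frac14+x^2}+\dfrac{x^2}{\nu-\frac32\lambda+\sqrt{(\nu-\lambda)^2-\frac14+x^2}}}$, $\nu_L^{(0,3)}=\frac12$, $\nu_U^{(0,3)}=\frac32$.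
   Context: $I_\nu(x)$ and $K_\nu(x)$ denote the modified Bessel functions of the first and second kind, of real order $\nu$ and real argument $x>0$. The subscript $\lambda$ takes the values $-1$ (lower bounds) and $+1$ (upper bounds), and $(p,q)$ is a label running over the nine pairs listed.
   Formalization: Items 7 and 9 are false as printed; the inner denominators are corrected to ν+√((ν−2λ)²+x²) in item 7 and ν−λ/2+√((ν−λ)²−1/4+x²) in item 9. Where a formula divides by zero at an endpoint (items 2 and 5), 1/0 is read as +∞ and 1/(+∞) as 0. *)

(* Defs.v *)
From HB Require Import structures.
From mathcomp Require Import all_boot all_order all_algebra.
From mathcomp Require Import all_classical all_reals all_analysis.

Set Implicit Arguments.
Unset Strict Implicit.
Unset Printing Implicit Defensive.

Import Order.TTheory GRing.Theory Num.Theory.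
Import numFieldNormedType.Exports.

Local Open Scope classical_set_scope.
Local Open Scope ring_scope.

(* Euler's integral; only meaningful for z > 0. *)
Definition Gamma {R : realType} (z : R) : R :=
  \int[lebesgue_measure]_(t in `]0, +oo[) (t `^ (z - 1) * expR (- t)).

(* The entire function 1 / Gamma on all of R: for z <= 0 the functional
   equation Gamma (z + n) = z (z + 1) ... (z + n - 1) Gamma z is used with an n
   such that z + n > 0, so that the value is 0 at the poles 0, -1, -2, ... *)
Definition rGamma {R : realType} (z : R) : R :=
  if 0 < z then (Gamma z)^-1
  else let n := (Num.truncn (- z)).+1 in
       (\prod_(i < n) (z + i%:R)) / Gamma (z + n%:R).

Definition besselI {R : realType} (nu x : R) : R :=
  limn (series (fun k : nat =>
    (x / 2) `^ (nu + k.*2%:R) * rGamma (nu + k%:R + 1) / k`!%:R)).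

(* K_nu(x) = int_0^oo exp (- x cosh t) cosh (nu t) dt, valid for x > 0 and every
   real order, integer orders included. *)
Definition cosh {R : realType} (t : R) : R := (expR t + expR (- t)) / 2.

Definition besselK {R : realType} (nu x : R) : R :=
  \int[lebesgue_measure]_(t in `[0, +oo[) (expR (- (x * cosh t)) * cosh (nu * t)).

(* The constructor Bpq stands for the label (p, q). *)
Variant bound_label := B01 | B10 | B02 | B11 | B20 | B12 | B21 | B30 | B03.

Definition nuL {R : realType} (pq : bound_label) : R :=
  match pq with
  | B01 => - 1
  | B10 => 1
  | B02 => - (1 / 2)
  | B11 => 0
  | B20 => 1
  | B12 => 3 / 2
  | B21 => - 1
  | B30 => 3
  | B03 => 1 / 2
  end.

Definition nuU {R : realType} (pq : bound_label) : R :=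
  match pq with
  | B01 => 0
  | B10 => 0
  | B02 => 1 / 2
  | B11 => - 1
  | B20 => 2
  | B12 => 1 / 2
  | B21 => 0
  | B30 => 2
  | B03 => 3 / 2
  end.

(* sqrt (a^2 + (a / b) x^2) in the extended reals, where a / 0 = +oo for
   a > 0. *)
Definition esqrt_ratio {R : realType} (a b x : R) : \bar R :=
  (sqrte ((a ^+ 2)%:E + a%:E / b%:E * (x ^+ 2)%:E))%E.

(* The denominator of F_lam^(p,q)(nu, x).  Extended reals are needed at closed
   endpoints of the ranges: B10 and B20 are +oo for lam = -1, nu = 1, and B10
   is 0 for lam = 1, nu = 0.

   The two inner offsets nu (in B21) and nu - lam / 2 (in B03) correct misprints
   of the source, which has nu - lam and nu - 3 lam / 2.  The misprinted bounds
   are false, e.g. for (0,3), lam = -1, nu = 1/2, x = 1, where the product is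
   (1 - exp(-2)) / 2 = 0.4323... and the "lower bound" is 0.4409..., and for
   (2,1), lam = 1, nu = 1/2, x = 10, where the product is
   (1 - exp(-20)) / 20 = 0.04999999... and the "upper bound" is 0.04996...
   The corrected terms come from
     1 / (I_nu K_nu) = x I_(nu-1) / I_nu + x^2 / (x K_nu / K_(nu-1))
                     = x K_(nu+1) / K_nu + x^2 / (x I_nu / I_(nu+1))
   and the bounds
     x I_(mu-1) / I_mu > mu - 1 + sqrt ((mu + 1)^2 + x^2),
     x K_(mu+1) / K_mu < mu + 1 + sqrt ((mu - 1)^2 + x^2)
   for (2,1), respectively
     x I_(mu-1) / I_mu > mu - 1/2 + sqrt (mu^2 - 1/4 + x^2),
     x K_(mu+1) / K_mu < mu + 1/2 + sqrt (mu^2 - 1/4 + x^2)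
   for (0,3). *)
Definition denF {R : realType} (pq : bound_label) (lam nu x : R) : \bar R :=
  match pq with
  | B01 => (Num.sqrt (nu ^+ 2 + x ^+ 2)
            + Num.sqrt ((nu - lam) ^+ 2 + x ^+ 2) - lam)%:E
  | B10 => (2%:E * esqrt_ratio nu (nu + lam) x)%E
  | B02 => (2 * Num.sqrt ((nu - lam / 2) ^+ 2 + x ^+ 2))%:E
  | B11 => (Num.sqrt (nu ^+ 2 + x ^+ 2)
            + Num.sqrt ((nu + lam) ^+ 2 + x ^+ 2) - lam)%:E
  | B20 => (esqrt_ratio (nu - 2 * lam)%R (nu - lam)%R x
            + esqrt_ratio nu (nu + lam)%R x + (2 * lam)%:E)%E
  | B12 => (nu + lam / 2 + Num.sqrt ((nu - lam / 2) ^+ 2 + x ^+ 2)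
            + x ^+ 2 / (nu + lam / 2
                        + Num.sqrt ((nu + 3 * lam / 2) ^+ 2 + x ^+ 2)))%:E
  | B21 => (nu - lam + Num.sqrt ((nu + lam) ^+ 2 + x ^+ 2)
            + x ^+ 2 / (nu + Num.sqrt ((nu - 2 * lam) ^+ 2 + x ^+ 2)))%:E
  | B30 => (nu + 2 * lam
            + Num.sqrt ((nu - 2 * lam) ^+ 2
                        + (nu - 2 * lam) / (nu - lam) * x ^+ 2)
            + x ^+ 2 / (nu + lam
                        + Num.sqrt ((nu + 3 * lam) ^+ 2
                            + (nu + 3 * lam) / (nu + 2 * lam) * x ^+ 2)))%:E
  | B03 => (nu - lam / 2 + Num.sqrt (nu ^+ 2 - 1 / 4 + x ^+ 2)
            + x ^+ 2 / (nu - lam / 2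
                        + Num.sqrt ((nu - lam) ^+ 2 - 1 / 4 + x ^+ 2)))%:E
  end.

Definition boundF {R : realType} (pq : bound_label) (lam nu x : R) : \bar R :=
  ((denF pq lam nu x)^-1)%E.

(* Main.v *)
(* With y = x^2/4, write I_v(x) = (x/2)^v H_v(y) and K_v(x) = (2/x)^v G_v(y) / 2,
   where G_v(y) = int_R exp (v t - e^t - y e^(-t)) dt and G_v(0) = Gamma(v).
   Then H_v' = H_(v+1), G_v' = - G_(v-1), and both families satisfy a three-term
   recurrence.  The Wronskian relation H_v G_(v+1) + y H_(v+1) G_v = 1 gives
     1 / (I_v K_v) = k_v + x^2 / h_(v+1) = h_v + x^2 / k_(v-1) = h_v + k_v - 2 v
   with h_v = x I_(v-1) / I_v and k_v = x K_(v+1) / K_v.  The ratios h_v and k_v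
   solve Riccati equations, hence are compared with al + sqrt (D + g x^2) by
   looking at the sign of the Riccati defect of the latter, from x = 0 for h_v
   and from x = +oo for k_v.  The recurrences turn a bound on h_(v+1) or k_(v-1)
   into one on h_v or k_v, and all nine pairs of bounds are sums of two bounds of
   this kind. *)
Require Import Defs.
From HB Require Import structures.
From mathcomp Require Import all_boot all_order all_algebra.
From mathcomp Require Import all_classical all_reals all_analysis.
From mathcomp Require Import measurable_realfun ring lra.

Import Order.TTheory GRing.Theory Num.Theory.
Import numFieldNormedType.Exports.

Local Open Scope ring_scope.
Local Open Scope classical_set_scope.

(** A bound [f] on a ratio is studied through a difference free of quotients, such as
    [E = H_(v-1) - f H_v]. With [r] the Riccati defect of [f] and [s] its square root,
    [y E' = H_v r / s - f E] on the [H] side and [y E' = - G_v r / s + f E] on the [G] side. If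
    [r > 0], a nonpositive [E] is pushed up in the first equation, so the sign at 0 decides, where
    [H_(v-1)(0) = v H_v(0)]. In the second it is pushed further down, against the decay of [E] at
    infinity; a crude bound on [y^2 G_v] thus replaces the asymptotics of [K]. Strictness is
    delicate at the elementary orders. For [K] at orders -1/2 and 1/2 some bounds are equalities, so
    they are proved with [<=] and the strictness of the product bound comes from the [I] side. For
    [I] at order 1/2 the defect vanishes identically and the equation for [E] is integrated
    explicitly. At order -1 the constant term of [H_v] is zero, so positivity of [H_v] has to come
    from its next term. *)

(** * Integrals over the real line as limits over symmetric intervals *)

Definition symm_itv (R : realType) (n : nat) : set R := `[- n%:R, n%:R]%classic.

Lemma bigcup_symm_itv (R : realType) : \bigcup_n symm_itv R n = [set: R].
Proof.
rewrite -subTset => t _; exists (Num.truncn `|t|).+1 => //=.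
by rewrite /symm_itv/= in_itv/= -ler_norml ltW// truncnS_gt.
Qed.

Lemma nondecreasing_symm_itv (R : realType) : nondecreasing_seq (symm_itv R).
Proof.
move=> m n mn; apply/subsetPset => t; rewrite /symm_itv/= !in_itv/= -!ler_norml.
by move=> /le_trans; apply; rewrite ler_nat.
Qed.

Lemma FTC2_itv (R : realType) (F f : R -> R) (a b : R) : a < b ->
  (forall t, is_derive t (1 : R) F (f t)) -> continuous f ->
  (\int[lebesgue_measure]_(t in `[a, b]) (f t)%:E = (F b - F a)%:E)%E.
Proof.
move=> ab dF cf; rewrite (@continuous_FTC2 _ _ F) -?EFinB//.
- exact: continuous_subspaceT.
- have cF : continuous F.
    by move=> t; apply/differentiable_continuous/derivable1_diffP; case: (dF t).
  split.
  + by move=> t _; case: (dF t).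
  + exact: cvg_at_right_filter (cF a).
  + exact: cvg_at_left_filter (cF b).
- by move=> t _; rewrite derive1E; apply: derive_val.
Qed.

(** By monotone convergence the integral is the limit of [F n - F (- n)], which never exceeds
    [C]. *)
Lemma integrable_bounded_primitive (R : realType) (F f : R -> R) (C : R) :
  (forall t, is_derive t (1 : R) F (f t)) -> continuous f ->
  (forall t, 0 <= f t) -> (forall t, 0 <= F t <= C) ->
  lebesgue_measure.-integrable [set: R] (EFin \o f).
Proof.
move=> dF cf f0 FC.
have mf : measurable_fun [set: R] (EFin \o f).
  by apply/measurable_EFinP; exact: continuous_measurable_fun.
apply/integrableP; split => //.
under eq_integral do rewrite /= ger0_norm//.
apply: (@le_lt_trans _ _ C%:E); last exact: ltry.
rewrite -bigcup_symm_itv.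
have : (\int[lebesgue_measure]_(t in symm_itv R n) (f t)%:E)%E @[n --> \oo]
    --> (\int[lebesgue_measure]_(t in \bigcup_n symm_itv R n) (f t)%:E)%E.
  apply: ge0_nondecreasing_set_cvg_integral.
  - exact: nondecreasing_symm_itv.
  - by move=> n; exact: measurable_itv.
  - by move=> n; exact: measurable_funS mf.
  - by move=> n t _; rewrite lee_fin.
move=> cvgi; rewrite -(cvg_lim _ cvgi)//; apply: lime_le.
  by apply/cvg_ex; eexists; exact: cvgi.
exists 1%N => // n /= n1.
have n0 : 0 < n%:R :> R by rewrite ltr0n.
rewrite (@FTC2_itv _ F)//; last lra.
by rewrite lee_fin; have := FC n%:R; have := FC (- n%:R); lra.
Qed.

Lemma integral_symm_itv_cvg (R : realType) (f : R -> R) :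
  lebesgue_measure.-integrable [set: R] (EFin \o f) ->
  (\int[lebesgue_measure]_(t in symm_itv R n) (f t)%:E)%E @[n --> \oo]
    --> (\int[lebesgue_measure]_t (f t)%:E)%E.
Proof.
move=> fi.
have mf : measurable_fun [set: R] (EFin \o f) by case/integrableP : fi.
have mS n : measurable (symm_itv R n) by exact: measurable_itv.
under eq_cvg do rewrite integral_mkcond.
have [] := @dominated_convergence _ _ _ (@lebesgue_measure R) setT measurableT
  (fun n : nat => (EFin \o f) \_ (symm_itv R n)) (EFin \o f)
  (fun t => `|(EFin \o f) t|%E) => //.
- move=> n; apply: (proj1 (measurable_restrictT (EFin \o f) (mS n))).
  exact: measurable_funS mf.
- apply: aeW => t _; apply: cvg_near_cst.
  exists (Num.truncn `|t|).+1 => // n /= tn.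
  rewrite patchE mem_set//= /symm_itv/= in_itv/= -ler_norml.
  by rewrite (le_trans (ltW (truncnS_gt _)))// ler_nat.
- exact: integrable_abse.
- apply: aeW => t n _; rewrite patchE; case: ifP => // _.
  by rewrite abse0.
Qed.

(** Integration by parts without boundary terms: applied to the kernel as primitive, it yields the
    recurrences of [GK] in the order. *)
Lemma integral_derivative_eq0 (R : realType) (F f : R -> R) :
  (forall t, is_derive t (1 : R) F (f t)) -> continuous f ->
  lebesgue_measure.-integrable [set: R] (EFin \o f) ->
  F n%:R @[n --> \oo] --> 0 -> F (- n%:R) @[n --> \oo] --> 0 ->
  \int[lebesgue_measure]_t f t = 0.
Proof.
move=> dF cf fi F1 F2; rewrite /Rintegral.
have /cvg_lim <- // := @integral_symm_itv_cvg _ _ fi.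
suff /cvg_lim -> // : (\int[lebesgue_measure]_(t in symm_itv R n)
   (f t)%:E)%E @[n --> \oo] --> (0 : R)%:E by [].
apply: (@cvg_trans _ ((F n%:R - F (- n%:R))%:E @[n --> \oo])).
  apply: near_eq_cvg; exists 1%N => // n /= n1.
  have n0 : 0 < n%:R :> R by rewrite ltr0n.
  by rewrite (@FTC2_itv _ F)//; lra.
apply: cvg_EFin; first by apply: nearW.
by rewrite -(subr0 0); apply: cvgB.
Qed.

Lemma integrable_dominated (R : realType) (f g : R -> R) (C : R) :
  continuous f -> (forall t, `|f t| <= C * g t) ->
  lebesgue_measure.-integrable [set: R] (EFin \o g) ->
  lebesgue_measure.-integrable [set: R] (EFin \o f).
Proof.
move=> cf fg gi.
apply: (@le_integrable _ _ _ lebesgue_measure _ measurableT _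
  (fun t => C%:E * (EFin \o g) t)%E).
- by apply/measurable_EFinP; exact: continuous_measurable_fun.
- by move=> t _ /=; rewrite lee_fin (le_trans (fg t))// ler_norm.
- exact: integrableZl.
Qed.

(** * The kernel of the Euler-type integral: integrability, positivity, decay *)

Definition gker (R : realType) (p y t : R) : R :=
  expR (p * t - expR t - y * expR (- t)).

Arguments gker {R} p y t.

(* Equals int_0^oo u^(p-1) exp (- u - y/u) du, through u = exp t. *)
HB.lock Definition GK (R : realType) (p y : R) : R :=
  \int[lebesgue_measure]_t gker p y t.
Arguments GK {R} p y.

Section kernel.
Context {R : realType}.
Implicit Types p y t : R.

Lemma gker_ge0 p y t : 0 <= gker p y t. Proof. exact: expR_ge0. Qed.

Lemma is_derive_gker p y t : is_derive t (1 : R) (gker p y)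
  (p * gker p y t - gker (p + 1) y t + y * gker (p - 1) y t).
Proof.
have -> : gker p y =
  expR \o ((p \*: id) - expR - (y \*: (expR \o -%R)))%R by [].
apply: is_derive_eq.
rewrite /gker /=.
have -> : (p + 1) * t - expR t - y * expR (- t) =
  t + (p * t - expR t - y * expR (- t)) by ring.
have -> : (p - 1) * t - expR t - y * expR (- t) =
  - t + (p * t - expR t - y * expR (- t)) by ring.
rewrite !expRD /GRing.scale/=.
ring.
Qed.

Lemma continuous_gker p y : continuous (gker p y).
Proof.
move=> t; apply/differentiable_continuous/derivable1_diffP.
by case: (is_derive_gker p y t).
Qed.

(** The right-hand side is the maximum over [t], attained at [ln (p / c)]; the inequality is
    [1 + z <= exp z] with [z] the distance to that point. *)
Lemma linear_sub_expR_le p c t : 0 < p -> 0 < c ->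
  p * t - c * expR t <= p * ln (p / c) - p.
Proof.
move=> p0 c0.
have pc0 : 0 < p / c by rewrite divr_gt0.
have -> : c * expR t = p * expR (t - ln (p / c)).
  by rewrite expRB lnK ?posrE//; field; rewrite !gt_eqF.
have := expR_ge1Dx (t - ln (p / c)).
rewrite -(ler_pM2l p0); lra.
Qed.

Lemma expR_linear_sub_expR_bounded p c : 0 < p -> 0 < c ->
  exists2 C, 0 < C & forall t, expR (p * t - c * expR t) <= C.
Proof.
move=> p0 c0; exists (expR (p * ln (p / c) - p)) => [|t]; first exact: expR_gt0.
by rewrite ler_expR; exact: linear_sub_expR_le.
Qed.

Lemma gker_le p y z t : y <= z -> gker p z t <= gker p y t.
Proof.
by move=> yz; rewrite ler_expR lerD2l lerN2 ler_wpM2r// expR_ge0.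
Qed.

(** The kernel is dominated by a multiple of the derivative of the logistic function [u / (1 + u)]
    with [u = exp (p t)], a bounded primitive. *)
Lemma integrable_gker0 p : 0 < p ->
  lebesgue_measure.-integrable [set: R] (EFin \o gker p 0).
Proof.
move=> p0.
have pp0 : 0 < 2 * p by lra.
have [C1 C10 HC1] := expR_linear_sub_expR_bounded p 1 p0 ltr01.
have [C2 C20 HC2] := expR_linear_sub_expR_bounded (2 * p) 1 pp0 ltr01.
pose u t := expR (p * t).
pose F t := u t / (1 + u t).
pose f t := p * u t / (1 + u t) ^+ 2.
have u0 t : 0 < u t by exact: expR_gt0.
have du t : is_derive t (1 : R) u (p * u t).
  have -> : u = expR \o (p \*: id) by [].
  by apply: is_derive_eq; rewrite /GRing.scale/= /u; ring.
have dF t : is_derive t (1 : R) F (f t).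
  have -> : F = cst 1 - (fun s => ((cst 1 + u) s)^-1).
    by apply/funext => s; rewrite /F/= !fctE; have := u0 s => us; field; lra.
  have n0 : (cst 1 + u) t != 0.
    by rewrite fctE gt_eqF// addr_gt0 ?u0 ?ltr01.
  have dV : is_derive t (1 : R) (fun s => ((cst 1 + u) s)^-1)
    (- ((cst 1 + u) t) ^- 2 *: (0 + p * u t)) by apply: is_deriveV.
  apply: is_derive_eq.
  by rewrite /f /GRing.scale/= !fctE/=; have := u0 t => ut; field; lra.
have cf : continuous f.
  have cu : continuous u.
    by move=> t; apply/differentiable_continuous/derivable1_diffP; case: (du t).
  move=> t; apply: cvgM; first by apply: cvgM; [exact: cvg_cst|exact: cu].
  apply: cvgV; first by rewrite expf_neq0//; have := u0 t; lra.
  under eq_cvg do rewrite expr2.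
  by apply: cvgM; apply: cvgD; (exact: cvg_cst || exact: cu).
have f0 t : 0 <= f t.
  by rewrite /f divr_ge0 ?sqr_ge0// mulr_ge0 ?(ltW p0) ?(ltW (u0 t)).
have fi : lebesgue_measure.-integrable [set: R] (EFin \o f).
  apply: (@integrable_bounded_primitive _ F f 1) => // t.
  have := u0 t; rewrite /F => ut.
  by rewrite divr_ge0 ?ler_pdivrMr/=; lra.
(* Expanding [(1 + u)^2 exp (- exp t)] gives three terms bounded by [1], [2 C1] and [C2]; the
   division by [p] cancels the factor [p] in [f]. *)
pose C := (1 + 2 * C1 + C2) / p.
have C0 : 0 < C by rewrite divr_gt0//; lra.
apply: (@integrable_dominated _ _ f C) => // [|t]; first exact: continuous_gker.
rewrite ger0_norm ?gker_ge0//.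
rewrite /f mulrA ler_pdivlMr ?exprn_gt0//; last by have := u0 t; lra.
rewrite /C mulrA divfK ?gt_eqF//.
have -> : gker p 0 t = u t * expR (- expR t).
  by rewrite /gker mul0r subr0 expRD.
rewrite -mulrA [leRHS]mulrC ler_wpM2l ?(ltW (u0 t))//.
have H1 := HC1 t; have H2 := HC2 t.
rewrite mul1r expRD in H1; rewrite mul1r expRD in H2.
have u2 : expR (2 * p * t) = u t ^+ 2.
  by rewrite /u -expRM_natl; congr expR; ring.
rewrite u2 in H2.
have H0 : expR (- expR t) <= 1 by rewrite expR_le1 oppr_le0 expR_ge0.
rewrite -/(u t) in H1.
have -> : expR (- expR t) * (1 + u t) ^+ 2 = expR (- expR t) +
  2 * (u t * expR (- expR t)) + u t ^+ 2 * expR (- expR t) by ring.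
lra.
Qed.

(** The two sources of convergence at minus infinity: the factor [exp (- y exp (- t))], or
    [exp (p t)]. The second admits [y = 0], where [GK] is the Gamma function. *)
Definition gker_dom p y := (0 < y) || ((0 < p) && (0 <= y)).

Lemma gker_dom_pos p y : 0 < y -> gker_dom p y.
Proof. by rewrite /gker_dom => ->. Qed.

Lemma gker_dom_pos_order p y : 0 < p -> 0 <= y -> gker_dom p y.
Proof. by rewrite /gker_dom => -> ->; rewrite orbT. Qed.

Lemma integrable_gker p y : gker_dom p y ->
  lebesgue_measure.-integrable [set: R] (EFin \o gker p y).
Proof.
move=> /orP[y0|/andP[p0 y0]]; last first.
  apply: (@integrable_dominated _ _ (gker p 0) 1) => [|t|].
  - exact: continuous_gker.
  - by rewrite ger0_norm ?gker_ge0// mul1r gker_le.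
  - exact: integrable_gker0.
(* Raising the order by [m] makes it positive; the compensating factor [exp (- m t)] is absorbed by
   [exp (- y exp (- t))]. *)
pose m := `|p| + 1.
have m0 : 0 < m by rewrite /m; have := normr_ge0 p; lra.
have pm0 : 0 < p + m by rewrite /m; have := ler_norm (- p); rewrite normrN; lra.
have [C C0 HC] := expR_linear_sub_expR_bounded m y m0 y0.
apply: (@integrable_dominated _ _ (gker (p + m) 0) C) => [|t|].
- exact: continuous_gker.
- rewrite ger0_norm ?gker_ge0//.
  have -> : gker p y t = expR (m * - t - y * expR (- t)) * gker (p + m) 0 t.
    by rewrite /gker -expRD; congr expR; ring.
  by rewrite ler_wpM2r// gker_ge0.
- exact: integrable_gker0.
Qed.

Lemma GK_gt0 p y : gker_dom p y -> 0 < GK p y.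
Proof.
move=> D; rewrite GK.unlock.
(* A lower bound of the kernel on [[0, 1]], which makes the integral strictly positive. *)
pose c := expR (- `|p| - expR 1 - `|y|).
pose g : R -> R := fun t => c * \1_(`[0, 1]%classic : set R) t.
have gi : lebesgue_measure.-integrable [set: R] (EFin \o g).
  have := integrableZl measurableT c (@integrable_indic_itv R 0 1 true false).
  by apply: eq_integrable => // t _ /=; rewrite /g EFinM.
apply: (@lt_le_trans _ _ (\int[lebesgue_measure]_t g t)); last first.
  apply: le_Rintegral => // [|t _]; first exact: integrable_gker.
  rewrite /g indicE; case: (boolP (_ \in _)) => [|_]; last first.
    by rewrite mulr0 gker_ge0.
  rewrite inE/= in_itv/= => /andP[t0 t1]; rewrite mulr1 ler_expR.
  have h1 : expR t <= expR 1 by rewrite ler_expR.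
  have h2 : - `|p| <= p * t.
    by have := ler_norm (- p); have := normr_ge0 p; rewrite normrN; nra.
  have h3 : y * expR (- t) <= `|y|.
    have e1 : expR (- t) <= 1 by rewrite expR_le1; lra.
    have := expR_ge0 (- t); have := ler_norm y; have := normr_ge0 y; nra.
  lra.
rewrite /g RintegralZl//; last exact: integrable_indic_itv.
rewrite mulr_gt0 ?expR_gt0//.
rewrite /Rintegral integral_indic// setIT.
have : 0 < fine (lebesgue_measure (`[0, 1]%classic : set R)).
  by rewrite lebesgue_measure_itv/= lte_fin ltr01 -EFinB/= subr0.
exact.
Qed.

Lemma gker_decay_y p y : 0 <= y ->
  gker p y n%:R @[n --> \oo] --> 0.
Proof.
move=> y0.
(* The extra 1 in the exponent leaves a spare factor [exp (- n)]. *)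
have q0 : 0 < `|p| + 1 by have := normr_ge0 p; lra.
have [C C0 HC] := expR_linear_sub_expR_bounded _ 1 q0 ltr01.
apply: (@squeeze_cvgr _ _ _ _ (fun=> 0) (fun n => C * expR (- n%:R))).
- apply: nearW => n; rewrite gker_ge0/=.
  apply: (le_trans (gker_le _ _ _ _ y0)).
  have := HC n%:R; rewrite mul1r => H.
  apply: (@le_trans _ _ (expR ((`|p| + 1) * n%:R - expR n%:R) * expR (- n%:R))).
    rewrite /gker -expRD ler_expR.
    have := ler_norm p; have := ler0n R n; nra.
  by rewrite ler_wpM2r// expR_ge0.
- exact: cvg_cst.
- by rewrite -(mulr0 C); apply: cvgM; [exact: cvg_cst|exact: cvgn_expR].
Qed.

Lemma gker_decay_Ny p y : gker_dom p y ->
  gker p y (- n%:R) @[n --> \oo] --> 0.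
Proof.
move=> /orP[y0|/andP[p0 y0]].
  have q0 : 0 < `|p| + 1 by have := normr_ge0 p; lra.
  have [C C0 HC] := expR_linear_sub_expR_bounded _ y q0 y0.
  apply: (@squeeze_cvgr _ _ _ _ (fun=> 0) (fun n => C * expR (- n%:R))).
  - apply: nearW => n; rewrite gker_ge0/=.
    apply: (@le_trans _ _ (expR ((`|p| + 1) * n%:R - y * expR n%:R) *
        expR (- n%:R))).
      rewrite /gker opprK -expRD ler_expR.
      have := ler_norm (- p); have := ler0n R n; have := expR_ge0 (- n%:R : R).
      by rewrite normrN; nra.
    by rewrite ler_wpM2r ?expR_ge0.
  - exact: cvg_cst.
  - by rewrite -(mulr0 C); apply: cvgM; [exact: cvg_cst|exact: cvgn_expR].
apply: (@squeeze_cvgr _ _ _ _ (fun=> 0) (fun n => expR (- p) ^+ n)).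
- apply: nearW => n; rewrite gker_ge0/=.
  rewrite -expRM_natl ler_expR.
  have := expR_ge0 (- n%:R : R); have := expR_ge0 (- - n%:R : R).
  have := ler0n R n; nra.
- exact: cvg_cst.
- by apply: cvg_expr; rewrite ger0_norm ?expR_ge0// expR_lt1; lra.
Qed.

End kernel.

(** * [GK]: recurrence, derivative, behaviour at 0 and at infinity *)

Lemma integrableZ_EFin (R : realType) (a : R) (f : R -> R) :
  lebesgue_measure.-integrable [set: R] (EFin \o f) ->
  lebesgue_measure.-integrable [set: R] (EFin \o (fun t => a * f t)).
Proof. exact: integrableZl. Qed.

Lemma integrableD_EFin (R : realType) (f g : R -> R) :
  lebesgue_measure.-integrable [set: R] (EFin \o f) ->
  lebesgue_measure.-integrable [set: R] (EFin \o g) ->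
  lebesgue_measure.-integrable [set: R] (EFin \o (fun t => f t + g t)).
Proof. exact: integrableD. Qed.

Lemma integrableB_EFin (R : realType) (f g : R -> R) :
  lebesgue_measure.-integrable [set: R] (EFin \o f) ->
  lebesgue_measure.-integrable [set: R] (EFin \o g) ->
  lebesgue_measure.-integrable [set: R] (EFin \o (fun t => f t - g t)).
Proof. exact: integrableB. Qed.

Lemma norm_expR_sub_le (R : realType) (z : R) :
  `|expR z - 1 - z| <= z ^+ 2 * expR `|z|.
Proof.
have h1 := expR_ge1Dx z; have h2 := expR_ge1Dx (- z).
have e0 := expR_gt0 z; have e := expRxMexpNx_1 z.
have h3 : expR z - 1 <= z * expR z by nra.
rewrite ger0_norm; last lra.
have [z0|z0] := leP 0 z.
  by rewrite ger0_norm//; nra.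
rewrite ltr0_norm//.
have : 1 <= expR (- z) by lra.
nra.
Qed.

(** Allows differentiation under the integral sign: a pointwise quadratic error of the integrand
    integrates to a quadratic error of the integral. *)
Lemma is_derive_quadratic_error (R : realType) (f : R -> R) (x l e C : R) :
  0 < e ->
  (forall d, `|d| < e -> `|f (x + d) - f x - d * l| <= C * d ^+ 2) ->
  is_derive x (1 : R) f l.
Proof.
move=> e0 H.
suff Hc : h^-1 *: (f (h *: 1 + x) - f x) @[h --> 0^'] --> l.
  split; first by apply/cvg_ex; exists l.
  exact: cvg_lim Hc.
apply/cvgrPdist_le => /= eps eps0.
near=> h.
have h0 : h != 0 by near: h; exact: nbhs_dnbhs_neq.
have he : `|h| < e by near: h; apply: dnbhs0_lt.
have hC : `|h| < eps / (`|C| + 1).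
  by near: h; apply: dnbhs0_lt; rewrite divr_gt0// ltr_wpDl.
rewrite /GRing.scale/= mulr1 (addrC h).
have hn0 : 0 < `|h| by rewrite normr_gt0.
rewrite distrC -(ler_pM2l hn0) -normrM mulrBr mulrA mulfV// mul1r.
apply: (le_trans (H h he)); rewrite -[h ^+ 2]ger0_norm ?sqr_ge0// normrX.
have C1 : 0 < `|C| + 1 by rewrite ltr_wpDl.
rewrite ltr_pdivlMr// in hC.
have := ler_norm C; nra.
Unshelve. all: by end_near.
Qed.

Section GK_theory.
Context {R : realType}.
Implicit Types p y : R.

Lemma GK_le p y z : gker_dom p y -> y <= z -> GK p z <= GK p y.
Proof.
move=> D yz; rewrite GK.unlock; apply: le_Rintegral => //.
- apply: integrable_gker; move: D; rewrite /gker_dom => /orP[y0|/andP[p0 y0]].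
    by rewrite (lt_le_trans y0 yz).
  by rewrite p0 (le_trans y0 yz) orbT.
- exact: integrable_gker.
- by move=> t _; exact: gker_le.
Qed.

Lemma GK_rec p y : 0 < y -> GK (p + 1) y = p * GK p y + y * GK (p - 1) y.
Proof.
move=> y0.
have I q : lebesgue_measure.-integrable [set: R] (EFin \o gker q y).
  by apply: integrable_gker; exact: gker_dom_pos.
have IB : lebesgue_measure.-integrable [set: R]
    (EFin \o (fun t => p * gker p y t - gker (p + 1) y t)).
  by apply: integrableB_EFin => //; exact: integrableZ_EFin.
have := @integral_derivative_eq0 R (gker p y) _ (is_derive_gker p y).
rewrite RintegralD//; last exact: integrableZ_EFin.
rewrite RintegralB//; last exact: integrableZ_EFin.
rewrite !RintegralZl//.
move=> H.
suff : p * GK p y - GK (p + 1) y + y * GK (p - 1) y = 0.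
  by rewrite addrAC => /eqP; rewrite subr_eq0 => /eqP ->.
rewrite GK.unlock; apply: H.
- move=> t; apply: cvgD; last first.
    by apply: cvgM; [exact: cvg_cst|exact: continuous_gker].
  apply: cvgB; last exact: continuous_gker.
  by apply: cvgM; [exact: cvg_cst|exact: continuous_gker].
- by apply: integrableD_EFin => //; exact: integrableZ_EFin.
- by apply: gker_decay_y; exact: ltW.
- by apply: gker_decay_Ny; exact: gker_dom_pos.
Qed.

(** The functional equation of Gamma. It is kept apart from [GK_rec] because the kernel of order
    [p - 1] need not be integrable at [y = 0]. *)
Lemma GK_rec0 p : 0 < p -> GK (p + 1) 0 = p * GK p 0.
Proof.
move=> p0.
have I : lebesgue_measure.-integrable [set: R] (EFin \o gker p 0).
  exact: integrable_gker0.
have I1 : lebesgue_measure.-integrable [set: R] (EFin \o gker (p + 1) 0).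
  by apply: integrable_gker0; lra.
have dg t : is_derive t (1 : R) (gker p 0) (p * gker p 0 t - gker (p + 1) 0 t).
  by apply: is_derive_eq (is_derive_gker p 0 t) _; rewrite mul0r addr0.
have := @integral_derivative_eq0 R (gker p 0) _ dg.
rewrite RintegralB//; last exact: integrableZ_EFin.
rewrite !RintegralZl//.
move=> H; suff : p * GK p 0 - GK (p + 1) 0 = 0.
  by move=> /eqP; rewrite subr_eq0 => /eqP ->.
rewrite GK.unlock; apply: H.
- move=> t; apply: cvgB; last exact: continuous_gker.
  by apply: cvgM; [exact: cvg_cst|exact: continuous_gker].
- by apply: integrableB_EFin => //; exact: integrableZ_EFin.
- exact: gker_decay_y.
- by apply: gker_decay_Ny; exact: gker_dom_pos_order.
Qed.

Lemma is_derive_GK p y : 0 < y -> is_derive y (1 : R) (GK p) (- GK (p - 1) y).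
Proof.
move=> y0; have y20 : 0 < y / 2 by lra.
have I q z : 0 < z -> lebesgue_measure.-integrable [set: R] (EFin \o gker q z).
  by move=> z0; apply: integrable_gker; exact: gker_dom_pos.
(* With [s = exp (- t)] the remainder is at most [(d s)^2 exp (|d| s)] times the kernel. The factor
   [s^2] lowers the order by 2, and [|d| < y / 2] costs half of the argument. *)
apply: (@is_derive_quadratic_error _ _ _ _ (y / 2) (GK (p - 2) (y / 2)))
  => // d dy.
have yd0 : 0 < y + d by have := ler_norm (- d); rewrite normrN; lra.
pose f t := (gker p (y + d) t - gker p y t) + d * gker (p - 1) y t.
have IB : lebesgue_measure.-integrable [set: R]
    (EFin \o (fun t => gker p (y + d) t - gker p y t)).
  by apply: integrableB_EFin => //; exact: I.
have If : lebesgue_measure.-integrable [set: R] (EFin \o f).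
  by apply: integrableD_EFin => //; apply: integrableZ_EFin; exact: I.
have -> : GK p (y + d) - GK p y - d * - GK (p - 1) y =
    \int[lebesgue_measure]_t f t.
  rewrite GK.unlock /f RintegralD//; last by apply: integrableZ_EFin; exact: I.
  rewrite RintegralB//; [|exact: I|exact: I].
  by rewrite RintegralZl//; [rewrite mulrN opprK|exact: I].
apply: (le_trans (le_normr_Rintegral _ _)) => //.
rewrite mulrC GK.unlock -RintegralZl//; last exact: I.
apply: le_Rintegral => //.
- exact: integrable_norm.
- by apply: integrableZ_EFin; exact: I.
move=> t _; pose s := expR (- t).
have s0 : 0 < s by exact: expR_gt0.
have -> : f t = gker p y t * (expR (- (d * s)) - 1 - - (d * s)).
  have -> : gker p y t * (expR (- (d * s)) - 1 - - (d * s)) =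
    gker p y t * expR (- (d * s)) - gker p y t + d * (gker p y t * s) by ring.
  rewrite /f /gker -!expRD -/s; congr (expR _ - _ + d * expR _); ring.
rewrite normrM ger0_norm ?gker_ge0//.
apply: (@le_trans _ _ (gker p y t * ((d * s) ^+ 2 * expR (`|d| * s)))).
  rewrite ler_wpM2l ?gker_ge0//.
  by have := norm_expR_sub_le R (- (d * s));
    rewrite normrN normrM (gtr0_norm s0) sqrrN.
have -> : gker p y t * ((d * s) ^+ 2 * expR (`|d| * s)) =
    d ^+ 2 * (gker p y t * s ^+ 2 * expR (`|d| * s)) by ring.
rewrite ler_wpM2l ?sqr_ge0// /s -expRM_natl /gker -!expRD ler_expR -/s.
have : `|d| * s <= y / 2 * s by rewrite ler_wpM2r ?(ltW s0)// ltW.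
lra.
Qed.

(** Integrates [1 - z <= exp (- z)] with [z = y exp (- t)]; [1 < p] makes the order [p - 1]
    integrable at 0. *)
Lemma GK_near0 p y : 1 < p -> 0 <= y ->
  GK p 0 - y * GK (p - 1) 0 <= GK p y <= GK p 0.
Proof.
move=> p1 y0; have p0 : 0 < p by lra.
rewrite GK_le ?andbT//; last exact: gker_dom_pos_order.
have I0 : lebesgue_measure.-integrable [set: R] (EFin \o gker p 0).
  exact: integrable_gker0.
have I1 : lebesgue_measure.-integrable [set: R] (EFin \o gker (p - 1) 0).
  by apply: integrable_gker0; lra.
rewrite GK.unlock -RintegralZl// -RintegralB//; last exact: integrableZ_EFin.
apply: le_Rintegral => //.
- by apply: integrableB_EFin => //; exact: integrableZ_EFin.
- by apply: integrable_gker; exact: gker_dom_pos_order.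
move=> t _.
have -> : gker (p - 1) 0 t = gker p 0 t * expR (- t).
  by rewrite /gker -expRD; congr expR; ring.
have -> : gker p y t = gker p 0 t * expR (- (y * expR (- t))).
  by rewrite /gker -expRD; congr expR; ring.
have := expR_ge1Dx (- (y * expR (- t))); have := gker_ge0 p 0 t; nra.
Qed.

(** With [s = exp (- t)], squaring [y <= 4 exp (y s / 4) / s] trades [y^2] for two more units of
    order and half of the argument, and [y / 2 >= 1 / 2] makes the bound uniform. The power 2 is
    what the linear growth allowed for [f] in [Gdef_decay] calls for. *)
Lemma GK_decay p : exists C, forall y, 1 <= y -> y ^+ 2 * GK p y <= C.
Proof.
exists (16 * GK (p + 2) (1 / 2)) => y y1.
have y0 : 0 < y by lra.
have I q z : 0 < z -> lebesgue_measure.-integrable [set: R] (EFin \o gker q z).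
  by move=> z0; apply: integrable_gker; exact: gker_dom_pos.
rewrite GK.unlock -!RintegralZl//; [|apply: I; lra|exact: I].
apply: le_Rintegral => //; [| |move=> t _].
- by apply: integrableZ_EFin; exact: I.
- by apply: integrableZ_EFin; apply: I; lra.
apply: (@le_trans _ _ (16 * gker (p + 2) (y / 2) t)); last first.
  by rewrite ler_pM2l// gker_le//; lra.
pose s := expR (- t); have s0 : 0 < s by exact: expR_gt0.
have -> : gker (p + 2) (y / 2) t = gker p y t * (expR (y * s / 4) / s) ^+ 2.
  rewrite exprMn exprVn -!expRM_natl -expRN /gker -!expRD -/s.
  by congr expR; field.
have h : y * s <= 4 * expR (y * s / 4) by have := expR_ge1Dx (y * s / 4); lra.
have h2 : y <= 4 * (expR (y * s / 4) / s).
  by rewrite mulrA ler_pdivlMr.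
have := gker_ge0 p y t.
have : y ^+ 2 <= 16 * (expR (y * s / 4) / s) ^+ 2 by nra.
nra.
Qed.

End GK_theory.

(** * Gamma and [K] expressed through [GK] *)

Section Gamma_GK.
Context {R : realType}.
Implicit Types p y x t : R.

Lemma GammaE p : 0 < p -> Gamma p = GK p 0.
Proof.
move=> p0; rewrite /Gamma GK.unlock /Rintegral; congr fine.
pose G (t : R) := t `^ (p - 1) * expR (- t).
(* The images of the symmetric intervals under [exp]: the substitution is made on compact intervals,
   and the limit is taken on both sides. *)
pose S n : set R := `[expR (- n%:R), expR n%:R]%classic.
have US : \bigcup_n S n = `]0, +oo[%classic.
  apply/seteqP; split=> [t [n _]|t]; rewrite /S/= !in_itv/= andbT.
    by case/andP=> h _; apply: lt_le_trans h; exact: expR_gt0.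
  move=> t0; exists (Num.truncn `|ln t|).+1 => //=.
  have : `|ln t| <= (Num.truncn `|ln t|).+1%:R by rewrite ltW// truncnS_gt.
  by rewrite in_itv/= ler_norml -ler_expR -[X in _ && X]ler_expR lnK ?posrE.
have cG t : 0 < t -> {for t, continuous G}.
  move=> t0; apply: cvgM.
    have : derivable (fun s : R => s `^ (p - 1)) t 1.
      by case: (is_derive1_powR (p - 1) t0).
    by move=> /derivable1_diffP/differentiable_continuous.
  by apply: continuous_comp; [exact: continuousN|exact: continuous_expR].
have G0 t : 0 <= G t by rewrite mulr_ge0 ?powR_ge0 ?expR_ge0.
have mS n : measurable (S n) by exact: measurable_itv.
have cS n : {within S n, continuous G}.
  apply: continuous_in_subspaceT => t; rewrite inE /S/= in_itv/= => /andP[h _].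
  by apply: cG; apply: lt_le_trans h; exact: expR_gt0.
have mG n : measurable_fun (S n) (EFin \o G).
  by apply/measurable_EFinP; exact: subspace_continuous_measurable_fun.
have nS : nondecreasing_seq S.
  move=> m n mn; apply/subsetPset => t; rewrite /S/= !in_itv/= => /andP[h1 h2].
  have mnR : m%:R <= n%:R :> R by rewrite ler_nat.
  by rewrite (le_trans _ h1) ?(le_trans h2)// ler_expR; lra.
rewrite -US.
have /cvg_lim <- // : (\int[lebesgue_measure]_(t in S n) (G t)%:E)%E
  @[n --> \oo]
    --> (\int[lebesgue_measure]_(t in \bigcup_n S n) (G t)%:E)%E.
  apply: ge0_nondecreasing_set_cvg_integral => //.
  by move=> n t _; rewrite lee_fin.
have /cvg_lim <- // := integral_symm_itv_cvg R _ (integrable_gker0 p p0).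
congr (lim (_ @ \oo)); apply/funext => n.
have dE : expR^`() = expR :> (R -> R).
  by apply/funext => t; rewrite derive1E; exact: derive_val.
rewrite /S integration_by_substitution_increasing//.
- apply: eq_integral => t _; rewrite dE; congr EFin.
  rewrite /G/= fctE/= -expRM -mulrA -!expRD /gker mul0r subr0; congr expR.
  by ring.
- by rewrite ge0_cp// oppr_le0.
- by move=> a b _ _ ab; rewrite ltr_expR.
- by move=> t _; rewrite dE; exact: continuous_expR.
- rewrite dE; apply/cvg_ex; exists (expR (- n%:R)).
  by apply: cvg_at_right_filter; exact: continuous_expR.
- rewrite dE; apply/cvg_ex; exists (expR n%:R).
  by apply: cvg_at_left_filter; exact: continuous_expR.
- split; first by move=> t _; exact: derivable_expR.
  + by apply: cvg_at_right_filter; exact: continuous_expR.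
  + by apply: cvg_at_left_filter; exact: continuous_expR.
- exact: cS.
Qed.

(** Matches the half-line integral with [cosh (nu t)] defining [K] with an integral of a single
    exponential over the whole line. *)
Lemma ge0_integral_fold (f : R -> R) : (forall t, 0 <= f t) -> continuous f ->
  (\int[lebesgue_measure]_t (f t)%:E =
   \int[lebesgue_measure]_(t in `[0%R, +oo[) (f t + f (- t))%:E)%E.
Proof.
move=> f0 cf.
have mf : measurable_fun [set: R] f by exact: continuous_measurable_fun.
have mfN : measurable_fun [set: R] (f \o -%R).
  by apply: measurableT_comp.
under [RHS]eq_integral do rewrite EFinD.
rewrite ge0_integralD//=; first last.
- by apply/measurable_EFinP; exact: measurable_funTS.
- by move=> t _; rewrite lee_fin.
- by apply/measurable_EFinP; exact: measurable_funTS.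
- by move=> t _; rewrite lee_fin.
rewrite -(setUv (`[0%R, +oo[%classic : set R)) ge0_integral_setU//=;
  last 4 first.
- exact: measurableC.
- by apply/measurable_EFinP; rewrite setUv.
- by move=> t _; rewrite lee_fin.
- exact/disj_setPCl.
congr (_ + _)%E.
rewrite setCitvr integral_itv_bndo_bndc; last first.
  by apply/measurable_EFinP; exact: measurable_funTS.
rewrite -{1}oppr0 ge0_integration_by_substitutionNy//.
exact: continuous_subspaceT.
Qed.

Lemma integral_translate (f : R -> R) c : (forall t, 0 <= f t) ->
  continuous f ->
  (\int[lebesgue_measure]_t (f (t + c))%:E
    = \int[lebesgue_measure]_t (f t)%:E)%E.
Proof.
move=> f0 cf; pose F t : R := t + c.
have dF t : is_derive t (1 : R) F 1.
  by have -> : F = id + cst c by []; apply: is_derive_eq; rewrite addr0.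
have F1 : F^`() = cst 1.
  by apply/funext => t; rewrite derive1E; apply: derive_val.
rewrite [RHS](@increasing_ge0_integration_by_substitutionT _ F)//.
- by apply: eq_integral => t _; rewrite F1/= fctE/= mulr1.
- by move=> a b; rewrite /F ltrD2r.
- by rewrite F1; exact: cst_continuous.
- by rewrite F1; exact: is_cvg_cst.
- by rewrite F1; exact: is_cvg_cst.
- apply/cvgrNyPle => A; exists (A - c); split; first exact: num_real.
  by move=> t /= tA; rewrite /F; lra.
- apply/cvgryPge => A; exists (A - c); split; first exact: num_real.
  by move=> t /= tA; rewrite /F; lra.
Qed.

Lemma besselKE (nu x : R) : 0 < x ->
  besselK nu x = (2 / x) `^ nu * GK nu (x ^+ 2 / 4) / 2.
Proof.
move=> x0.
have x20 : 0 < x / 2 by rewrite divr_gt0.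
(* Translating by [c] makes the two exponentials of [x cosh t] into [exp (t + c)] and
   [y exp (- (t + c))], at the price of the factor [k]. *)
pose c := ln (x / 2); pose y := x ^+ 2 / 4.
pose k := (2 / x) `^ nu.
have y0 : 0 < y by rewrite divr_gt0// exprn_gt0.
have k0 : 0 <= k by exact: powR_ge0.
have kE : k = expR (- (nu * c)).
  rewrite /k -[2 / x]lnK ?posrE ?divr_gt0// -expRM; congr expR.
  by rewrite /c -invf_div lnV ?posrE//; ring.
have D := gker_dom_pos nu y y0.
have aE t : expR (nu * t - x * cosh t) = k * gker nu y (t + c).
  have e1 : expR (t + c) = expR t * (x / 2) by rewrite expRD lnK ?posrE.
  have e2 : expR (- (t + c)) = expR (- t) * (2 / x).
    by rewrite opprD expRD expRN [expR (- c)]expRN lnK ?posrE// invf_div.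
  rewrite kE /gker -expRD e1 e2; congr expR.
  by rewrite /cosh /y; field; rewrite gt_eqF.
rewrite /besselK /Rintegral.
have -> : (\int[lebesgue_measure]_(t in `[0%R, +oo[)
     (expR (- (x * cosh t)) * cosh (nu * t))%:E = 
   \int[lebesgue_measure]_(t in `[0%R, +oo[)
     (k / 2 * gker nu y (t + c) + k / 2 * gker nu y (- t + c))%:E)%E.
  apply: eq_integral => t _; congr EFin.
  have h1 := aE t; have h2 := aE (- t).
  have ch : cosh (- t) = cosh t by rewrite /cosh opprK addrC.
  rewrite ch mulrN in h2.
  rewrite {2}/cosh mulrA mulrDr -!expRD.
  have -> : k / 2 * gker nu y (t + c) = (k * gker nu y (t + c)) / 2 by ring.
  have -> : k / 2 * gker nu y (- t + c) = (k * gker nu y (- t + c)) / 2 by ring.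
  rewrite -h1 -h2 -mulrDl; congr (_ * _).
  by congr (expR _ + expR _); ring.
pose f t := k / 2 * gker nu y (t + c).
have f0 t : 0 <= f t by rewrite mulr_ge0 ?gker_ge0 ?divr_ge0.
have cf : continuous f.
  move=> t; apply: cvgM; first exact: cvg_cst.
  apply: (@continuous_comp _ _ _ (fun t => t + c) (gker nu y)).
    by apply: cvgD; [exact: cvg_id|exact: cvg_cst].
  exact: continuous_gker.
pose g t := k / 2 * gker nu y t.
have g0 t : 0 <= g t by rewrite mulr_ge0 ?gker_ge0 ?divr_ge0.
have cg : continuous g.
  by move=> t; apply: cvgM; [exact: cvg_cst|exact: continuous_gker].
have := ge0_integral_fold f f0 cf.
have := integral_translate g c g0 cg.
rewrite /f /g => -> <-.
have := @RintegralZl _ _ R lebesgue_measure _ (gker nu y) (k / 2) measurableT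
  (integrable_gker _ _ D).
rewrite {1}/Rintegral => ->.
rewrite GK.unlock; exact: mulrAC.
Qed.

End Gamma_GK.

(** * The reciprocal Gamma function on the whole line *)

Section rGamma_theory.
Context {R : realType}.
Implicit Types z : R.

Lemma Gamma_gt0 z : 0 < z -> 0 < Gamma z.
Proof. by move=> z0; rewrite GammaE// GK_gt0// gker_dom_pos_order. Qed.

Lemma GammaS z : 0 < z -> Gamma (z + 1) = z * Gamma z.
Proof. by move=> z0; rewrite !GammaE ?GK_rec0//; lra. Qed.

Lemma rGammaE z : 0 < z -> rGamma z = (Gamma z)^-1.
Proof. by rewrite /rGamma => ->. Qed.

Lemma rGamma_gt0 z : 0 < z -> 0 < rGamma z.
Proof. by move=> z0; rewrite rGammaE// invr_gt0 Gamma_gt0. Qed.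

(** Holds at the poles too. For [-1 < z <= 0] the product has the single factor [z]; for [z <= -1]
    passing to [z + 1] removes exactly the first factor. *)
Lemma rGamma_rec z : rGamma z = z * rGamma (z + 1).
Proof.
have [z0|z0] := ltP 0 z.
  have G0 := Gamma_gt0 z z0.
  rewrite !rGammaE//; last lra.
  by rewrite GammaS//; field; rewrite !gt_eqF.
have nz : 0 <= - z by lra.
have [z1|z1] := ltP 0 (z + 1).
  rewrite (rGammaE (z + 1))// /rGamma ltNge z0/=.
  have -> : Num.truncn (- z) = 0%N.
    by apply/eqP; rewrite truncn_eq// nz/=; lra.
  by rewrite big_ord_recl big_ord0/= addr0 mulr1.
rewrite /rGamma !ltNge z0 z1/=.
have -> : Num.truncn (- z) = (Num.truncn (- (z + 1))).+1.
  have h : 0 <= - (z + 1) by lra.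
  apply/eqP; rewrite truncn_eq//.
  have /andP[h1 h2] := truncn_itv h.
  by rewrite -!natr1 in h2 *; apply/andP; split; lra.
set n := Num.truncn _.
rewrite big_ord_recl/= addr0 -mulrA; congr (_ * (_ / _)).
  by apply: eq_bigr => i _; rewrite /bump/= natrD; ring.
by congr Gamma; rewrite -[in LHS]natr1; ring.
Qed.

Lemma rGamma0 : rGamma 0 = 0 :> R.
Proof. by rewrite rGamma_rec mul0r. Qed.

Lemma rGamma_ge0 z : 0 <= z -> 0 <= rGamma z.
Proof.
by rewrite le_eqVlt => /predU1P[<-|/rGamma_gt0/ltW//]; rewrite rGamma0.
Qed.

(** Once [z + k >= 1], the recurrence makes the absolute values nonincreasing in [k], so finitely
    many of them bound all. *)
Lemma rGamma_bounded z : exists C, forall k : nat, `|rGamma (z + k%:R)| <= C.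
Proof.
have [K zK] : exists K : nat, 1 <= z + K%:R.
  exists (Num.truncn `|z|).+2.
  have := truncnS_gt `|z|; have := ler_norm (- z); rewrite normrN -natr1; lra.
pose r (k : nat) : R := `|rGamma (z + k%:R)|.
exists (\sum_(0 <= i < K.+1) r i) => k; rewrite -/(r k).
have rK (j : nat) : (j <= K)%N -> r j <= \sum_(0 <= i < K.+1) r i.
  move=> jK; rewrite (bigD1_seq j) ?mem_index_iota//; last exact: iota_uniq.
  by rewrite lerDl sumr_ge0// => i _; rewrite normr_ge0.
have [kK|Kk] := leqP k K; first exact: rK.
apply: le_trans (rK K (leqnn K)).
suff step m : r (m + K)%N <= r K by rewrite -(subnK (ltnW Kk)).
elim: m => [|m IH]; first by rewrite add0n.
apply: le_trans IH; rewrite [leRHS]/r rGamma_rec normrM.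
have h : 1 <= z + (m + K)%:R by rewrite natrD; have := ler0n R m; lra.
have -> : z + (m + K)%:R + 1 = z + (m.+1 + K)%:R by rewrite addSn -natr1; ring.
by rewrite -/(r _) ler_peMl ?normr_ge0// ger0_norm//; lra.
Qed.

End rGamma_theory.

(** * The entire function [H_v]: derivative, recurrence, positivity *)

Definition Hcoef {R : realType} (v : R) (k : nat) : R :=
  rGamma (v + k%:R + 1) / k`!%:R.

(* I_v(x) = (x/2)^v H_v(x^2/4). *)
HB.lock Definition besselH (R : realType) (v y : R) : R :=
  limn (pseries (Hcoef v) y).
Arguments besselH {R} v y.

Section besselH_theory.
Context {R : realType}.
Implicit Types v y x : R.

(** Bounded reciprocal Gamma values leave a multiple of the exponential series at [|y|]. *)
Lemma is_cvg_Hseries v y : cvgn (pseries (Hcoef v) y).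
Proof.
have [C HC] := rGamma_bounded (v + 1).
apply: normed_cvg; apply: (@series_le_cvg _ _ (fun k => C * exp_coeff `|y| k)).
- by move=> k; rewrite normr_ge0.
- move=> k; rewrite mulr_ge0 ?exp_coeff_ge0//.
  by apply: le_trans (HC 0%N); rewrite normr_ge0.
- move=> k /=; rewrite /Hcoef !normrM /exp_coeff/= normrX.
  rewrite [`|_^-1|]ger0_norm ?invr_ge0// -mulrA [(_^-1 * _)]mulrC.
  rewrite ler_wpM2r ?mulr_ge0 ?exprn_ge0 ?invr_ge0//.
  by rewrite addrAC; exact: HC.
- apply: is_cvg_seriesZ; exact: is_cvg_series_exp_coeff.
Qed.

Lemma Hcoef_diffs v : pseries_diffs (Hcoef v) = Hcoef (v + 1).
Proof.
apply/funext => i; rewrite /pseries_diffs /Hcoef factS natrM invfM.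
have -> : v + i.+1%:R + 1 = v + 1 + i%:R + 1 by rewrite -natr1; ring.
by rewrite mulrCA; congr (_ * _); rewrite mulVKf// pnatr_eq0.
Qed.

Lemma is_derive_besselH v y :
  is_derive y (1 : R) (besselH v) (besselH (v + 1) y).
Proof.
rewrite besselH.unlock -Hcoef_diffs.
apply: (@pseries_snd_diffs _ _ (`|y| + 1)); rewrite ?Hcoef_diffs;
  try exact: is_cvg_Hseries.
by rewrite [ltRHS]ger0_norm ?ltrDl// addr_ge0.
Qed.

Lemma continuous_besselH v : continuous (besselH v).
Proof.
move=> y; apply/differentiable_continuous/derivable1_diffP.
by case: (is_derive_besselH v y).
Qed.

(** Coefficientwise this is [rGamma (v + k) = (v + k) rGamma (v + k + 1)]: the part [v] reproduces
    [H_v] and the part [k] gives [y] times the derivative series. *)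
Lemma besselH_rec v y :
  besselH (v - 1) y = v * besselH v y + y * besselH (v + 1) y.
Proof.
have c1 : pseries (Hcoef v) y @ \oo --> besselH v y.
  by rewrite besselH.unlock; exact: is_cvg_Hseries.
have c2 : series (fun i => i%:R * Hcoef v i * y ^+ i.-1) @ \oo -->
    besselH (v + 1) y.
  rewrite besselH.unlock -Hcoef_diffs; apply: pseries_diffs_equiv.
  by rewrite Hcoef_diffs; exact: is_cvg_Hseries.
rewrite {1}besselH.unlock; apply: cvg_lim => //.
have -> : pseries (Hcoef (v - 1)) y = fun n => v * pseries (Hcoef v) y n +
    y * series (fun i => i%:R * Hcoef v i * y ^+ i.-1) n.
  apply/funext => n; rewrite /pseries /series/= !big_distrr -big_split/=.
  apply: eq_bigr => i _; rewrite /Hcoef.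
  have -> : v - 1 + i%:R + 1 = v + i%:R by ring.
  rewrite rGamma_rec; case: i => [|i]/=; first by ring.
  by rewrite exprS; ring.
by apply: cvgD; [exact: (cvgM (cvg_cst v) c1)|exact: (cvgM (cvg_cst y) c2)].
Qed.

Lemma besselH_at0 v : besselH v 0 = rGamma (v + 1).
Proof.
rewrite besselH.unlock; apply: cvg_lim => //; rewrite -cvg_shiftS.
apply: cvg_near_cst; apply: nearW => n.
rewrite /pseries /series/= big_nat_recl//= big1 ?addr0.
  by rewrite expr0 mulr1 /Hcoef fact0 invr1 mulr1 addr0.
by move=> i _; rewrite exprS mul0r mulr0.
Qed.

Lemma Hcoef_ge0 v k : -1 <= v -> 0 <= Hcoef v k.
Proof.
move=> v1; rewrite /Hcoef mulr_ge0 ?invr_ge0// rGamma_ge0//.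
by have := ler0n R k; lra.
Qed.

Lemma besselH_ge v y n : -1 <= v -> 0 <= y ->
  pseries (Hcoef v) y n <= besselH v y.
Proof.
move=> v1 y0; rewrite besselH.unlock; apply: nondecreasing_cvgn_le;
  last exact: is_cvg_Hseries.
apply/nondecreasing_seqP => m; rewrite /pseries /series/= big_nat_recr//=.
by rewrite lerDl mulr_ge0 ?Hcoef_ge0 ?exprn_ge0.
Qed.

Lemma besselH_gt0 v y : -1 <= v -> 0 < y -> 0 < besselH v y.
Proof.
(* Two terms of the series are kept because the constant one vanishes at [v = -1]; the linear one is
   always positive. *)
move=> v1 y0; apply: (lt_le_trans _ (besselH_ge v y 2%N v1 (ltW y0))).
rewrite /pseries /series/= big_nat_recr//= big_nat1.
apply: ltr_wpDl; first by rewrite mulr_ge0 ?Hcoef_ge0 ?exprn_ge0 ?(ltW y0).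
rewrite mulr_gt0 ?exprn_gt0//.
by rewrite /Hcoef divr_gt0// rGamma_gt0//; lra.
Qed.

Lemma besselIE v x : 0 < x ->
  besselI v x = (x / 2) `^ v * besselH v (x ^+ 2 / 4).
Proof.
move=> x0; have x20 : 0 < x / 2 by rewrite divr_gt0.
apply: cvg_lim => //.
have c1 : pseries (Hcoef v) (x ^+ 2 / 4) @ \oo --> besselH v (x ^+ 2 / 4).
  by rewrite besselH.unlock; exact: is_cvg_Hseries.
rewrite [X in X @ \oo --> _](_ : _ =
    fun n => (x / 2) `^ v * pseries (Hcoef v) (x ^+ 2 / 4) n); last first.
  apply/funext => n; rewrite /pseries /series/= big_distrr/=.
  apply: eq_bigr => k _; rewrite powRD; last first.
    by apply/implyP => _; rewrite gt_eqF.
  rewrite powR_mulrn ?(ltW x20)// -mul2n exprM.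
  have -> : (x / 2) ^+ 2 = x ^+ 2 / 4 by field.
  by rewrite /Hcoef; ring.
by apply: cvgM => //; exact: cvg_cst.
Qed.

End besselH_theory.

(** * The Wronskian relation *)

Section Wronskian.
Context {R : realType}.
Implicit Types v y : R.

(** At [y = x^2 / 4] this is [x (I_v K_(v+1) + I_(v+1) K_v)]. *)
Definition wronskian v y : R :=
  besselH v y * GK (v + 1) y + y * besselH (v + 1) y * GK v y.

Lemma wronskian_pred v y : 0 < y -> wronskian (v - 1) y = wronskian v y.
Proof.
move=> y0; rewrite /wronskian besselH_rec.
have := GK_rec v y y0; rewrite !subrK => G1.
rewrite G1; ring.
Qed.

(** The derivative contains the orders [v + 2] of [H] and [v - 1] of [G]; the recurrences multiplied
    by [y] remove both and everything cancels. *)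
Lemma is_derive_wronskian v y : 0 < y ->
  is_derive y (1 : R) (wronskian v) 0.
Proof.
move=> y0.
have d1 := is_derive_besselH v y.
have d2 := is_derive_besselH (v + 1) y.
have d3 := is_derive_GK v y y0.
have d4 := is_derive_GK (v + 1) y y0.
have -> : wronskian v
  = (besselH v * GK (v + 1) + id * besselH (v + 1) * GK v)%R.
  by [].
apply: is_derive_eq.
rewrite /GRing.scale/= !fctE/= addrK.
have r1 : y * besselH (v + 1 + 1) y = besselH v y - (v + 1) * besselH (v + 1) y.
  by have := besselH_rec (v + 1) y; rewrite addrK => ->; ring.
have r2 : y * GK (v - 1) y = GK (v + 1) y - v * GK v y.
  by rewrite (GK_rec v y y0); ring.
rewrite !mulrN !mulr1.
move: r1 r2; move: (besselH (v + 1 + 1) y) (GK (v - 1) y).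
move: (besselH (v + 1) y) (GK (v + 1) y) (besselH v y) (GK v y).
move=> a b c d e f r1 r2.
transitivity ((a * b - c * d) + d * (y * e + a) - a * (y * f)); first by ring.
by rewrite r1 r2; ring.
Qed.

Lemma wronskian_cst v y z : 0 < y -> 0 < z -> wronskian v y = wronskian v z.
Proof.
wlog yz : y z / y < z.
  move=> H y0 z0; have [yz|zy|->//] := ltgtP y z; first exact: H.
  by apply/esym; exact: H.
move=> y0 z0.
have [c _] : exists2 c, c \in `]y, z[%R &
    wronskian v z - wronskian v y = 0 * (z - y).
  apply: (@MVT _ (wronskian v) (fun=> 0)) => //.
    move=> c; rewrite in_itv/= => /andP[yc _].
    by apply: is_derive_wronskian; exact: lt_trans yc.
  apply: derivable_within_continuous => c; rewrite in_itv/= => /andP[yc _].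
  by case: (is_derive_wronskian v c (lt_le_trans y0 yc)).
by rewrite mul0r => /eqP; rewrite subr_eq0 => /eqP.
Qed.

(** In the first term the limits are [1 / Gamma (v + 1)] and [Gamma (v + 1)]; [GK_near0] gives the
    latter, as [v + 1 > 1]. The second term is squeezed to 0 because [GK v] stays below its value at
    0. *)
Lemma wronskian_cvg v : 0 < v -> wronskian v y @[y --> 0^'+] --> (1 : R).
Proof.
move=> v0.
have v10 : 0 < v + 1 by lra.
have G0 := Gamma_gt0 (v + 1) v10.
have -> : 1 = rGamma (v + 1) * GK (v + 1) 0 + 0 * besselH (v + 1) 0 * 0 :> R.
  by rewrite mulr0 addr0 -GammaE// rGammaE// mulVf// gt_eqF.
have cH (u : R) : besselH u y @[y --> 0^'+] --> besselH u 0.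
  by apply: cvg_at_right_filter; exact: continuous_besselH.
have cid : y @[y --> 0^'+] --> (0 : R) by apply: cvg_at_right_filter;
  exact: cvg_id.
apply: cvgD.
  apply: cvgM; first by rewrite -besselH_at0; exact: cH.
  apply: (@squeeze_cvgr _ _ _ _ (fun y => GK (v + 1) 0 - y * GK v 0)
    (fun=> GK (v + 1) 0)).
  - near=> y; have y0 : 0 < y by near: y; exact: nbhs_right_gt.
    have v1 : 1 < v + 1 by lra.
    by have := GK_near0 (v + 1) y v1 (ltW y0); rewrite addrK.
  - rewrite -[X in _ --> X]subr0; apply: cvgB; first exact: cvg_cst.
    by rewrite -[X in _ --> X](mul0r (GK v 0));
      exact: (@cvgM _ _ _ _ _ (fun=> GK v 0) _ _ cid (cvg_cst _)).
  - exact: cvg_cst.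
have -> : 0 * besselH (v + 1) 0 * 0 = 0 * besselH (v + 1) 0 * (GK v 0) * 0 :> R.
  by rewrite !mulr0.
have b0 : y * besselH (v + 1) y @[y --> 0^'+] --> (0 * besselH (v + 1) 0 : R).
  by apply: cvgM.
rewrite mulr0 mul0r in b0 *.
apply: (@squeeze_cvgr _ _ _ _ (fun=> 0)
  (fun y => y * besselH (v + 1) y * GK v 0)).
- near=> y; have y0 : 0 < y by near: y; exact: nbhs_right_gt.
  have h1 : -1 <= v + 1 by lra.
  have H0 := besselH_gt0 (v + 1) y h1 y0.
  rewrite !mulr_ge0 ?(ltW y0) ?(ltW H0)//=; last first.
    by apply/ltW/GK_gt0; exact: gker_dom_pos.
  rewrite ler_wpM2l ?mulr_ge0 ?(ltW y0) ?(ltW H0)// GK_le ?(ltW y0)//.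
  exact: gker_dom_pos_order.
- exact: cvg_cst.
- by rewrite -[X in _ --> X](mul0r (GK v 0));
    exact: (@cvgM _ _ _ _ _ (fun=> GK v 0) _ _ b0 (cvg_cst _)).
Unshelve. all: by end_near.
Qed.

Lemma wronskianE v y : 0 < y -> wronskian v y = 1.
Proof.
move=> y0.
have pos u : 0 < u -> wronskian u y = 1.
  move=> u0.
  have : wronskian u z @[z --> 0^'+] --> wronskian u y.
    apply: cvg_near_cst; near=> z.
    have z0 : 0 < z by near: z; exact: nbhs_right_gt.
    exact: wronskian_cst.
  move=> /(cvg_lim (@Rhausdorff R)) <-.
  exact: (cvg_lim (@Rhausdorff R)) (wronskian_cvg u u0).
(* The value does not change under integer shifts of the order, so any [v] reduces to a positive
   one. *)
have shift (n : nat) u : wronskian u y = wronskian (u + n%:R) y.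
  elim: n u => [|n IH] u; first by rewrite addr0.
  by rewrite IH -natr1 addrA -[in RHS]wronskian_pred// addrK.
rewrite (shift (Num.truncn `|v|).+1); apply: pos.
by have := truncnS_gt `|v|; have := ler_norm (- v); rewrite normrN; lra.
Unshelve. all: by end_near.
Qed.

End Wronskian.

(** * Sign propagation from 0 and from infinity *)

Section minimum_principles.
Context {R : realType}.
Implicit Types (E : R -> R) (c l y : R).

Lemma is_derive_gt0_near E c l : is_derive c (1 : R) E l -> 0 < l :> R ->
  exists2 d, 0 < d & forall h, 0 < h < d -> E (c - h) < E c < E (c + h).
Proof.
move=> [dE El] l0.
have : h^-1 *: (E (h *: 1 + c) - E c) @[h --> 0^'] --> l.
  by rewrite -El; exact: dE.
move=> /cvgr_gt /(_ _ l0) [d /= d0 H].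
exists d => // h /andP[h0 hd].
have h1 : `|0 - h| < d by rewrite sub0r normrN gtr0_norm.
have h2 : `|0 - - h| < d by rewrite sub0r opprK gtr0_norm.
have := H h h1; have := H (- h) h2.
have hn : h != 0 by rewrite gt_eqF.
have nhn : - h != 0 by rewrite oppr_eq0.
move=> /(_ nhn) H1 /(_ hn) H2.
rewrite /GRing.scale/= mulr1 in H1; rewrite /GRing.scale/= mulr1 in H2.
rewrite invrN mulNr -mulrN pmulr_rgt0 ?invr_gt0// opprB subr_gt0 in H1.
rewrite pmulr_rgt0 ?invr_gt0// subr_gt0 in H2.
by rewrite addrC H1 addrC H2.
Qed.

(** If [E] were nonpositive at [y], a minimum over [[0, y]] would be nonpositive and could be taken
    at some [c > 0]; there [E' c > 0] makes [E] smaller just to the left. *)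
Lemma pos_of_min_principle E (E' : R -> R) :
  (forall y, 0 < y -> is_derive y (1 : R) E (E' y)) ->
  (forall y, 0 < y -> {within `[0, y], continuous E}) ->
  0 <= E 0 -> (forall y, 0 < y -> E y <= 0 -> 0 < E' y) ->
  forall y, 0 < y -> 0 < E y.
Proof.
move=> dE cE E0 H y y0; rewrite ltNge; apply/negP => Ey.
have [c cy cmin] := EVT_min (ltW y0) (cE y y0).
(* If the minimum sits at 0, then [E y <= 0 <= E 0] makes [y] a minimum as well. *)
have {c cy cmin}[c c0 cmin] : exists2 c, 0 < c <= y &
    forall t, t \in `[0, y]%R -> E c <= E t.
  move: cy; rewrite in_itv/= => /andP[];
    rewrite le_eqVlt => /predU1P[c0 _|c0 cy].
    exists y; first by rewrite y0 lexx.
    by move=> t /cmin; apply: le_trans; rewrite -c0; exact: le_trans E0.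
  by exists c => //; rewrite c0.
have /andP[c00 cy] := c0.
have Ec : E c <= 0.
  by apply: le_trans Ey; apply: cmin; rewrite in_itv/= lexx ltW.
have [d d0 Hd] := is_derive_gt0_near E c _ (dE c c00) (H c c00 Ec).
pose h := Num.min (d / 2) c.
have h0 : 0 < h by rewrite lt_min c00 andbT; lra.
have hd : h < d by rewrite gt_min; apply/orP; left; lra.
have hc : h <= c by rewrite ge_min lexx orbT.
have /andP[+ _] : E (c - h) < E c < E (c + h) by apply: Hd; rewrite h0.
rewrite ltNge cmin// in_itv/=; apply/andP; split; lra.
Qed.

(** Starting from a nonpositive value, [E] keeps decreasing and stays below a negative constant, so
    [y E y] tends to minus infinity. *)
Lemma decay_min_principle E (E' : R -> R) C y1 : 0 < y1 ->
  (forall y, 0 < y -> is_derive y (1 : R) E (E' y)) ->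
  (forall y, 1 <= y -> - C <= y * E y) -> E y1 <= 0 ->
  (forall y, y1 <= y -> E y <= E y1 -> E' y < 0) -> False.
Proof.
move=> y10 dE EC Ey1 H.
have right y : y1 <= y -> E y <= E y1 ->
    exists2 d, 0 < d & forall h, 0 < h < d -> E (y + h) < E y.
  move=> yy Ey.
  have dN : is_derive y (1 : R) (- E) (- E' y).
    by apply: is_deriveN; apply: dE; exact: lt_le_trans yy.
  have E'0 : 0 < - E' y by rewrite oppr_gt0 H.
  have [d d0 Hd] := is_derive_gt0_near _ _ _ dN E'0;
    exists d => // h /Hd/andP[_].
  by rewrite !fctE ltrN2.
(* The minimum over [[y1, z]] must be at [z]: at any earlier point the negative derivative would
   give a smaller value to the right. *)
have noninc z t : y1 <= t -> t <= z -> E z <= E t.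
  move=> y1t tz.
  have cE : {within `[y1, z], continuous E}.
    apply: derivable_within_continuous => c; rewrite in_itv/= => /andP[yc _].
    by case: (dE c (lt_le_trans y10 yc)).
  have [c] := EVT_min (le_trans y1t tz) cE.
  rewrite in_itv/= => /andP[y1c]; rewrite le_eqVlt => /predU1P[-> cmin|cz cmin].
    by apply: cmin; rewrite in_itv/= y1t.
  have Ec : E c <= E y1.
    by apply: cmin; rewrite in_itv/= lexx (le_trans y1t tz).
  have [d d0 Hd] := right c y1c Ec.
  pose h := Num.min (d / 2) (z - c).
  have h0 : 0 < h by rewrite lt_min; apply/andP; split; lra.
  have hd : h < d by rewrite gt_min; apply/orP; left; lra.
  have hc : h <= z - c by rewrite ge_min lexx orbT.
  have : E (c + h) < E c by apply: Hd; rewrite h0.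
  by rewrite ltNge cmin// in_itv/=; apply/andP; split; lra.
(* [E y1] itself may be 0; a small step to the right gives a strictly negative value [- e]. *)
have [d d0 Hd] := right y1 (lexx _) (lexx _).
have Et : E (y1 + d / 2) < E y1 by apply: Hd; lra.
pose t := y1 + d / 2; pose e := - E t.
have e0 : 0 < e by rewrite /e /t; lra.
(* At this [z] the product [z E z] is at most [- (|C| + 1)], below the assumed bound [- C]. *)
pose z := Num.max t (Num.max 1 ((`|C| + 1) / e)).
have zt : t <= z by rewrite le_max lexx.
have z1 : 1 <= z by rewrite !le_max lexx orbT.
have zC : `|C| + 1 <= z * e.
  by rewrite -ler_pdivrMr// !le_max lexx !orbT.
have y1t : y1 <= t by rewrite /t; lra.
have Ez : E z <= - e by rewrite opprK; exact: noninc.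
have := EC z z1; have := ler_norm C; nra.
Qed.

End minimum_principles.

(** * Comparison of the ratios with [al + sqrt (D + g x^2)] *)

Section Riccati_comparison.
Context {R : realType}.
Variables (v al D g : R).
Hypotheses (D0 : 0 <= D) (g0 : 0 < g).
Implicit Types y : R.

(** At [y = x^2 / 4] the function [f] is half of the bound, since [h_v] and [k_v] are twice
    quotients of [H] and of [G]. *)
Let s (y : R) : R := Num.sqrt (D + g * (4 * y)).
Let f (y : R) : R := (al + s y) / 2.

Let s_gt0 y : 0 < y -> 0 < s y.
Proof. by move=> y0; rewrite sqrtr_gt0; have := D0; have := g0; nra. Qed.

Let sqr_s y : 0 <= y -> s y ^+ 2 = D + g * (4 * y).
Proof. by move=> y0; rewrite sqr_sqrtr//; have := D0; have := g0; nra. Qed.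

Let is_derive_f y : 0 < y -> is_derive y (1 : R) f (g / s y).
Proof.
move=> y0.
have a0 : 0 < D + g * (4 * y) by have := D0; have := g0; nra.
have d1 : is_derive (D + g * (4 * y)) (1 : R) Num.sqrt
    (2 * Num.sqrt (D + g * (4 * y)))^-1 by exact: is_derive1_sqrt.
have dA : is_derive y (1 : R) (fun z => D + g * (4 * z)) (4 * g).
  have -> : (fun z => D + g * (4 * z)) = cst D + ((4 * g) \*: id).
    by apply/funext => z; rewrite !fctE/= /GRing.scale/=; ring.
  by apply: is_derive_eq; rewrite /GRing.scale/=; ring.
have ds : is_derive y (1 : R) s ((2 * s y)^-1 * (4 * g)).
  exact: (@is_derive1_comp _ Num.sqrt (fun z => D + g * (4 * z)) y).
have -> : f = (2^-1 \*: (cst al + s)).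
  by apply/funext => z; rewrite /f !fctE/= /GRing.scale/= mulrC.
apply: is_derive_eq; rewrite /GRing.scale/= add0r.
by field; rewrite gt_eqF// s_gt0.
Qed.

Let continuous_f : continuous f.
Proof.
move=> y; apply: cvgM; last exact: cvg_cst.
apply: cvgD; first exact: cvg_cst.
apply: (@continuous_comp R R R (fun z => D + g * (4 * z)) Num.sqrt).
  apply: cvgD; first exact: cvg_cst.
  by do 2 (apply: cvgM; first exact: cvg_cst); exact: cvg_id.
exact: sqrt_continuous.
Qed.

Let Hdef (y : R) := besselH (v - 1) y - f y * besselH v y.
Let Hdef' (y : R) := besselH v y -
  (g / s y * besselH v y + f y * besselH (v + 1) y).

Let is_derive_Hdef y : 0 < y -> is_derive y (1 : R) Hdef (Hdef' y).
Proof.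
move=> y0.
have d1 := is_derive_besselH (v - 1) y; rewrite subrK in d1.
have d2 := is_derive_besselH v y.
have d3 := is_derive_f y y0.
have d4 := is_deriveM d3 d2.
apply: is_derive_eq (is_deriveB d1 d4) _.
rewrite /Hdef' /GRing.scale/=; congr (_ - _).
by rewrite addrC (mulrC (besselH v y)).
Qed.

(** This is [s (y + v f - f^2 + e y f')] reduced by [s^2 = D + 4 g y]. The ratio [u = H_(v-1) / H_v]
    solves [y u' = y + v u - u^2], hence [e = -1]; [w = G_(v+1) / G_v] solves the equation with the
    opposite right-hand side, hence [e = 1]. *)
Let riccati (e y : R) : R :=
  s y * ((1 - g) * y + (2 * v * al - al ^+ 2 - D) / 4)
  + y * g * (2 * (v - al) + e) + (v - al) * D / 2.

Let Hdef_ode y : 0 < y ->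
  y * Hdef' y = besselH v y * (riccati (-1) y / s y) - f y * Hdef y.
Proof.
move=> y0; have s0 := s_gt0 y y0.
have r1 : y * besselH (v + 1) y = besselH (v - 1) y - v * besselH v y.
  by rewrite (besselH_rec v y); ring.
rewrite /Hdef' /Hdef /riccati.
have e1 : D = s y ^+ 2 - g * (4 * y) by rewrite (sqr_s y (ltW y0)); ring.
have -> : y * (besselH v y - (g / s y * besselH v y + f y * besselH (v + 1) y))
  = y * (besselH v y - g / s y * besselH v y) - f y * (y * besselH (v + 1) y).
  ring.
rewrite r1 /f e1; move: s0; move: (s y) (besselH v y) (besselH (v - 1) y).
by move=> t a b t0; field; rewrite gt_eqF.
Qed.

Let Gdef (y : R) := GK (v + 1) y - f y * GK v y.
Let Gdef' (y : R) := - GK v y -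
  (g / s y * GK v y + f y * - GK (v - 1) y).

Let is_derive_Gdef y : 0 < y -> is_derive y (1 : R) Gdef (Gdef' y).
Proof.
move=> y0.
have d1 := is_derive_GK (v + 1) y y0; rewrite addrK in d1.
have d2 := is_derive_GK v y y0.
have d3 := is_derive_f y y0.
have d4 := is_deriveM d3 d2.
apply: is_derive_eq (is_deriveB d1 d4) _.
rewrite /Gdef' /GRing.scale/=; congr (_ - _).
by rewrite addrC (mulrC (GK v y)).
Qed.

Let Gdef_ode y : 0 < y ->
  y * Gdef' y = - (GK v y * (riccati 1 y / s y)) + f y * Gdef y.
Proof.
move=> y0; have s0 := s_gt0 y y0.
have r1 : y * GK (v - 1) y = GK (v + 1) y - v * GK v y.
  by rewrite (GK_rec v y y0); ring.
rewrite /Gdef' /Gdef /riccati.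
have e1 : D = s y ^+ 2 - g * (4 * y) by rewrite (sqr_s y (ltW y0)); ring.
have -> : y * (- GK v y - (g / s y * GK v y + f y * - GK (v - 1) y))
  = y * (- GK v y - g / s y * GK v y) + f y * (y * GK (v - 1) y).
  ring.
rewrite r1 /f e1; move: s0; move: (s y) (GK v y) (GK (v + 1) y).
by move=> t a b t0; field; rewrite gt_eqF.
Qed.

Let continuous_Hdef : continuous Hdef.
Proof.
move=> y; apply: cvgB; first exact: continuous_besselH.
by apply: cvgM; [exact: continuous_f|exact: continuous_besselH].
Qed.

Let Gdef_decay : exists C : R, forall y, 1 <= y -> `|y * Gdef y| <= C.
Proof.
have [C1 H1] := @GK_decay R (v + 1); have [C2 H2] := @GK_decay R v.
pose c : R := `|al| + D + 4 * g + 1.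
have al0 := normr_ge0 al.
have D0' := D0; have g0' := g0.
have c0 : 0 < c by rewrite /c; lra.
exists (C1 + c * C2) => y y1.
have y0 : 0 < y by lra.
have G1 : 0 < GK (v + 1) y by apply/GK_gt0/gker_dom_pos.
have G2 : 0 < GK v y by apply/GK_gt0/gker_dom_pos.
have fy : `|f y| <= c * y.
  have s0 := s_gt0 y y0; have sq := sqr_s y (ltW y0).
  (* From [s <= s^2 + 1]; growth linear in [y] is good enough against [GK_decay]. *)
  have sy : s y <= D + g * (4 * y) + 1 by nra.
  have := ler_normD al (s y); rewrite [`|s y|]gtr0_norm// => h.
  rewrite /f normrM [`|2^-1|]ger0_norm//.
  have : 0 <= D * (y - 1) by rewrite mulr_ge0//; lra.
  have : 0 <= `|al| * (y - 1) by rewrite mulr_ge0//; lra.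
  rewrite /c; lra.
have := H1 y y1; have := H2 y y1 => h2 h1.
rewrite /Gdef mulrBr (le_trans (ler_normB _ _))// lerD//.
  rewrite ger0_norm ?mulr_ge0 ?(ltW y0) ?(ltW G1)//; apply: le_trans h1.
  by rewrite ler_wpM2r ?(ltW G1)// expr2 ler_peMl// ltW.
rewrite normrM (gtr0_norm y0) [`|f y * _|]normrM (gtr0_norm G2).
apply: (@le_trans _ _ (c * (y ^+ 2 * GK v y)));
  last by rewrite ler_wpM2l ?(ltW c0).
have -> : c * (y ^+ 2 * GK v y) = y * (c * y * GK v y) by ring.
by rewrite ler_wpM2l ?(ltW y0)// ler_wpM2r// ltW.
Qed.

Hypothesis f0 : forall y, 0 < y -> 0 < f y.

(** The condition on [al + sqrt D] says that the difference is nonnegative at 0, because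
    [H_(v-1)(0) = v H_v(0)]. *)
Lemma besselH_ratio_gt : -1 <= v -> al + Num.sqrt D <= 2 * v ->
  (forall y, 0 < y -> 0 < riccati (-1) y) ->
  forall y, 0 < y -> f y * besselH v y < besselH (v - 1) y.
Proof.
move=> v1 fv Hr y y0; rewrite -subr_gt0 -/(Hdef y).
apply: (@pos_of_min_principle _ Hdef Hdef') => //.
- by move=> z _; apply: continuous_subspaceT.
- rewrite /Hdef besselH_rec mul0r addr0 -mulrBl mulr_ge0//; last first.
    by rewrite besselH_at0 rGamma_ge0//; lra.
  by rewrite /f /s mulr0 mulr0 addr0; lra.
- move=> z z0 Ez; rewrite -(pmulr_rgt0 _ z0) Hdef_ode// ltr_pwDl//.
    by rewrite mulr_gt0 ?besselH_gt0// divr_gt0 ?s_gt0 ?Hr.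
  by rewrite oppr_ge0 pmulr_rle0 ?f0.
Qed.

Lemma besselH_ratio_lt : -1 <= v -> 2 * v <= al + Num.sqrt D ->
  (forall y, 0 < y -> riccati (-1) y < 0) ->
  forall y, 0 < y -> besselH (v - 1) y < f y * besselH v y.
Proof.
move=> v1 fv Hr y y0; rewrite -subr_gt0 -opprB -/(Hdef y).
apply: (@pos_of_min_principle _ (- Hdef) (fun z => - Hdef' z)) => //.
- by move=> z z0; apply: is_deriveN; exact: is_derive_Hdef.
- move=> z _; apply: continuous_subspaceT => t.
  by apply: cvgN; exact: continuous_Hdef.
- rewrite fctE /Hdef besselH_rec mul0r addr0 -mulrBl -mulNr mulr_ge0//;
    last first.
    by rewrite besselH_at0 rGamma_ge0//; lra.
  by rewrite /f /s mulr0 mulr0 addr0; lra.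
- move=> z z0; rewrite fctE oppr_le0 => Ez.
  rewrite -(pmulr_rgt0 _ z0) mulrN Hdef_ode// opprB addrC ltr_pwDl//.
    rewrite oppr_gt0 pmulr_rlt0 ?besselH_gt0// pmulr_llt0 ?invr_gt0 ?s_gt0//.
    exact: Hr.
  by rewrite mulr_ge0// ltW// f0.
Qed.

(* With al = D = 0 the deficit solves y E' = - f E, whose solutions are the
   multiples of exp (- 2 f). *)
Lemma besselH_ratio_gt_crit : al = 0 -> D = 0 -> 0 < v ->
  (forall y, 0 < y -> riccati (-1) y = 0) ->
  forall y, 0 < y -> f y * besselH v y < besselH (v - 1) y.
Proof.
move=> al0 D00 v0 Hr y y0; rewrite -subr_gt0 -/(Hdef y).
pose e : R -> R := expR \o (2 \*: f).
pose T : R -> R := Hdef * e.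
have ce : continuous e.
  move=> z; apply: (@continuous_comp R R R (2 \*: f) expR);
    last exact: continuous_expR.
  by apply: cvgM; [exact: cvg_cst|exact: continuous_f].
have dT (z : R) : 0 < z -> is_derive z (1 : R) T 0.
  move=> z0; have dH := is_derive_Hdef z z0; have df := is_derive_f z z0.
  have de : is_derive z (1 : R) e (expR (2 * f z) * (2 * (g / s z))).
    have d2 : is_derive z (1 : R) (2 \*: f) (2 * (g / s z))
      by exact: is_deriveZ.
    exact: (@is_derive1_comp _ expR (2 \*: f) z).
  apply: is_derive_eq (is_deriveM dH de) _.
  have s0 := s_gt0 z z0; have sq := sqr_s z (ltW z0).
  have h := Hdef_ode z z0; rewrite Hr// mul0r mulr0 sub0r in h.
  have -> : Hdef' z = - (f z * Hdef z) / z 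
    by rewrite -h mulrAC mulfV ?gt_eqF// mul1r.
  have -> : g = s z ^+ 2 / (4 * z).
    by rewrite sq D00; field; rewrite gt_eqF.
  rewrite /e /GRing.scale/= /f al0 add0r.
  by field; rewrite !gt_eqF.
have [c _] : exists2 c, c \in `]0, y[%R & T y - T 0 = 0 * (y - 0).
  apply: (@MVT _ T (fun=> 0)) => //.
    by move=> c; rewrite in_itv/= => /andP[c0 _]; exact: dT.
  apply: continuous_subspaceT => z.
  by apply: cvgM; [exact: continuous_Hdef|exact: ce].
rewrite mul0r => /eqP; rewrite subr_eq0 => /eqP Ty.
(* [T] is constant, so its value [v H_v(0)] at 0 fixes the sign of the difference everywhere. *)
have T0 : 0 < T 0.
  rewrite /T fctE mulr_gt0 ?expR_gt0// /Hdef besselH_rec mul0r addr0 -mulrBl.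
  rewrite mulr_gt0//; last by rewrite besselH_at0 rGamma_gt0//; lra.
  by rewrite /f /s al0 D00 mulr0 mulr0 addr0 sqrtr0 addr0 mul0r subr0.
by move: T0; rewrite -Ty /T fctE pmulr_lgt0 ?expR_gt0.
Qed.

Lemma GK_ratio_gt : (forall y, 0 < y -> 0 < riccati 1 y) ->
  forall y, 0 < y -> f y * GK v y < GK (v + 1) y.
Proof.
move=> Hr y y0; rewrite -subr_gt0 -/(Gdef y) ltNge; apply/negP => Ey.
have [C HC] := Gdef_decay.
apply: (@decay_min_principle _ Gdef Gdef' C y) => //.
- by move=> z /HC; rewrite ler_norml => /andP[].
- move=> z yz Ez; have z0 := lt_le_trans y0 yz.
  rewrite -(pmulr_rlt0 _ z0) Gdef_ode// ltr_nwDl//.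
    rewrite oppr_lt0 mulr_gt0//; first by apply/GK_gt0/gker_dom_pos.
    by rewrite divr_gt0 ?s_gt0 ?Hr.
  by rewrite pmulr_rle0 ?f0// (le_trans Ez).
Qed.

Lemma GK_ratio_lt : (forall y, 0 < y -> riccati 1 y < 0) ->
  forall y, 0 < y -> GK (v + 1) y < f y * GK v y.
Proof.
move=> Hr y y0; rewrite -subr_gt0 -opprB -/(Gdef y) ltNge; apply/negP => Ey.
have [C HC] := Gdef_decay.
apply: (@decay_min_principle _ (- Gdef) (fun z => - Gdef' z) C y) => //.
- by move=> z z0; apply: is_deriveN; exact: is_derive_Gdef.
- by move=> z /HC; rewrite -normrN -mulrN ler_norml => /andP[].
- move=> z yz Ez; have z0 := lt_le_trans y0 yz.
  rewrite -(pmulr_rlt0 _ z0) mulrN Gdef_ode// opprD opprK ltr_nwDl//.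
    rewrite pmulr_rlt0; last by apply/GK_gt0/gker_dom_pos.
    by rewrite pmulr_llt0 ?invr_gt0 ?s_gt0//; exact: Hr.
  by rewrite -mulrN pmulr_rle0 ?f0// (le_trans Ez).
Qed.

(** A defect that may vanish still works: assuming the difference strictly negative, the term [f E]
    alone makes the derivative strictly negative. *)
Lemma GK_ratio_le : (forall y, 0 < y -> riccati 1 y <= 0) ->
  forall y, 0 < y -> GK (v + 1) y <= f y * GK v y.
Proof.
move=> Hr y y0; rewrite -subr_ge0 -opprB -/(Gdef y) leNgt; apply/negP => Ey.
have [C HC] := Gdef_decay.
apply: (@decay_min_principle _ (- Gdef) (fun z => - Gdef' z) C y) => //.
- by move=> z z0; apply: is_deriveN; exact: is_derive_Gdef.
- by move=> z /HC; rewrite -normrN -mulrN ler_norml => /andP[].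
- exact: ltW.
- move=> z yz Ez; have z0 := lt_le_trans y0 yz.
  rewrite -(pmulr_rlt0 _ z0) mulrN Gdef_ode// opprD opprK ltr_nwDr//.
    by rewrite -mulrN pmulr_rlt0 ?f0// (le_lt_trans Ez).
  rewrite pmulr_rle0; last by apply/GK_gt0/gker_dom_pos.
  by rewrite pmulr_lle0 ?invr_gt0 ?s_gt0//; exact: Hr.
Qed.

End Riccati_comparison.

(** * The ratios [h_v] and [k_v] in the variable [x] *)

Section ratios.
Context {R : realType}.
Implicit Types v x al D g : R.

(** This is [h_v = x I_(v-1) / I_v]; the powers of [x / 2] combine with [x] to the factor 2.
    Likewise [ratioK] is [k_v = x K_(v+1) / K_v]. *)
Definition ratioI v x : R :=
  2 * besselH (v - 1) (x ^+ 2 / 4) / besselH v (x ^+ 2 / 4).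

Definition ratioK v x : R :=
  2 * GK (v + 1) (x ^+ 2 / 4) / GK v (x ^+ 2 / 4).

(** The square root is a free variable [s], so that each concrete defect is an algebraic identity in
    [y] and [s]. *)
Definition riccati_defect v al D g e (y s : R) : R :=
  s * ((1 - g) * y + (2 * v * al - al ^+ 2 - D) / 4)
  + y * g * (2 * (v - al) + e) + (v - al) * D / 2.

Let quarter_gt0 x : 0 < x -> 0 < x ^+ 2 / 4.
Proof. by move=> x0; rewrite divr_gt0// exprn_gt0. Qed.

Let quarterK x : 4 * (x ^+ 2 / 4) = x ^+ 2.
Proof. by field. Qed.

Let sqrt_spec D g (y : R) : 0 <= D -> 0 < g -> 0 < y ->
  0 < Num.sqrt (D + g * (4 * y)) /\
  Num.sqrt (D + g * (4 * y)) ^+ 2 = D + g * (4 * y).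
Proof.
move=> D0 g0 y0.
have h : 0 < D + g * (4 * y) by nra.
by rewrite sqrtr_gt0 h sqr_sqrtr// ltW.
Qed.

Lemma ratioI_gt v al D g x : 0 < x -> -1 <= v -> 0 <= D -> 0 < g ->
  al + Num.sqrt D <= 2 * v ->
  (forall y s : R, 0 < y -> 0 < s -> s ^+ 2 = D + g * (4 * y) ->
    0 < al + s /\ 0 < riccati_defect v al D g (-1) y s) ->
  al + Num.sqrt (D + g * x ^+ 2) < ratioI v x.
Proof.
move=> x0 v1 D0 g0 fv H.
rewrite ltr_pdivlMr; last by rewrite besselH_gt0 ?quarter_gt0.
rewrite -[X in g * X]quarterK.
suff : (al + Num.sqrt (D + g * (4 * (x ^+ 2 / 4)))) / 2 *
  besselH v (x ^+ 2 / 4) < besselH (v - 1) (x ^+ 2 / 4) by lra.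
apply: besselH_ratio_gt => // [y y0|y y0|]; last exact: quarter_gt0.
- have [s0 s2] := sqrt_spec D g y D0 g0 y0.
  by rewrite divr_gt0//; have [] := H y _ y0 s0 s2.
- have [s0 s2] := sqrt_spec D g y D0 g0 y0.
  by have [] := H y _ y0 s0 s2.
Qed.

Lemma ratioI_lt v al D g x : 0 < x -> -1 <= v -> 0 <= D -> 0 < g ->
  2 * v <= al + Num.sqrt D ->
  (forall y s : R, 0 < y -> 0 < s -> s ^+ 2 = D + g * (4 * y) ->
    0 < al + s /\ riccati_defect v al D g (-1) y s < 0) ->
  ratioI v x < al + Num.sqrt (D + g * x ^+ 2).
Proof.
move=> x0 v1 D0 g0 fv H.
rewrite ltr_pdivrMr; last by rewrite besselH_gt0 ?quarter_gt0.
rewrite -[X in g * X]quarterK.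
suff : besselH (v - 1) (x ^+ 2 / 4) <
  (al + Num.sqrt (D + g * (4 * (x ^+ 2 / 4)))) / 2 *
  besselH v (x ^+ 2 / 4) by lra.
apply: besselH_ratio_lt => // [y y0|y y0|]; last exact: quarter_gt0.
- have [s0 s2] := sqrt_spec D g y D0 g0 y0.
  by rewrite divr_gt0//; have [] := H y _ y0 s0 s2.
- have [s0 s2] := sqrt_spec D g y D0 g0 y0.
  by have [] := H y _ y0 s0 s2.
Qed.

Let GK_pos v x : 0 < x -> 0 < GK v (x ^+ 2 / 4).
Proof. by move=> x0; apply/GK_gt0/gker_dom_pos; exact: quarter_gt0. Qed.

Lemma ratioK_gt v al D g x : 0 < x -> 0 <= D -> 0 < g ->
  (forall y s : R, 0 < y -> 0 < s -> s ^+ 2 = D + g * (4 * y) ->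
    0 < al + s /\ 0 < riccati_defect v al D g 1 y s) ->
  al + Num.sqrt (D + g * x ^+ 2) < ratioK v x.
Proof.
move=> x0 D0 g0 H.
rewrite ltr_pdivlMr ?GK_pos// -[X in g * X]quarterK.
suff : (al + Num.sqrt (D + g * (4 * (x ^+ 2 / 4)))) / 2 *
  GK v (x ^+ 2 / 4) < GK (v + 1) (x ^+ 2 / 4) by lra.
apply: GK_ratio_gt => // [y y0|y y0|]; last exact: quarter_gt0.
- have [s0 s2] := sqrt_spec D g y D0 g0 y0.
  by rewrite divr_gt0//; have [] := H y _ y0 s0 s2.
- have [s0 s2] := sqrt_spec D g y D0 g0 y0.
  by have [] := H y _ y0 s0 s2.
Qed.

Lemma ratioK_lt v al D g x : 0 < x -> 0 <= D -> 0 < g ->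
  (forall y s : R, 0 < y -> 0 < s -> s ^+ 2 = D + g * (4 * y) ->
    0 < al + s /\ riccati_defect v al D g 1 y s < 0) ->
  ratioK v x < al + Num.sqrt (D + g * x ^+ 2).
Proof.
move=> x0 D0 g0 H.
rewrite ltr_pdivrMr ?GK_pos// -[X in g * X]quarterK.
suff : GK (v + 1) (x ^+ 2 / 4) <
  (al + Num.sqrt (D + g * (4 * (x ^+ 2 / 4)))) / 2 * GK v (x ^+ 2 / 4) by lra.
apply: GK_ratio_lt => // [y y0|y y0|]; last exact: quarter_gt0.
- have [s0 s2] := sqrt_spec D g y D0 g0 y0.
  by rewrite divr_gt0//; have [] := H y _ y0 s0 s2.
- have [s0 s2] := sqrt_spec D g y D0 g0 y0.
  by have [] := H y _ y0 s0 s2.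
Qed.

Lemma ratioK_le v al D g x : 0 < x -> 0 <= D -> 0 < g ->
  (forall y s : R, 0 < y -> 0 < s -> s ^+ 2 = D + g * (4 * y) ->
    0 < al + s /\ riccati_defect v al D g 1 y s <= 0) ->
  ratioK v x <= al + Num.sqrt (D + g * x ^+ 2).
Proof.
move=> x0 D0 g0 H.
rewrite ler_pdivrMr ?GK_pos// -[X in g * X]quarterK.
suff : GK (v + 1) (x ^+ 2 / 4) <=
  (al + Num.sqrt (D + g * (4 * (x ^+ 2 / 4)))) / 2 * GK v (x ^+ 2 / 4) by lra.
apply: GK_ratio_le => // [y y0|y y0|]; last exact: quarter_gt0.
- have [s0 s2] := sqrt_spec D g y D0 g0 y0.
  by rewrite divr_gt0//; have [] := H y _ y0 s0 s2.
- have [s0 s2] := sqrt_spec D g y D0 g0 y0.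
  by have [] := H y _ y0 s0 s2.
Qed.

Lemma ratioI_gt0 v x : 0 < x -> 0 <= v -> 0 < ratioI v x.
Proof.
move=> x0 v0; rewrite divr_gt0 ?mulr_gt0 ?besselH_gt0 ?quarter_gt0//; lra.
Qed.

Lemma ratioK_gt0 v x : 0 < x -> 0 < ratioK v x.
Proof. by move=> x0; rewrite divr_gt0 ?mulr_gt0 ?GK_pos. Qed.

Lemma ratioI_rec v x : 0 < x -> -1 <= v ->
  ratioI v x = 2 * v + x ^+ 2 / ratioI (v + 1) x.
Proof.
move=> x0 v1.
have H1 : 0 < besselH v (x ^+ 2 / 4) by rewrite besselH_gt0 ?quarter_gt0.
have H2 : 0 < besselH (v + 1) (x ^+ 2 / 4)
  by rewrite besselH_gt0 ?quarter_gt0//; lra.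
rewrite /ratioI addrK (besselH_rec v).
move: H1 H2; move: (besselH v _) (besselH (v + 1) _) => a b a0 b0.
by field; rewrite !gt_eqF.
Qed.

Lemma ratioK_rec v x : 0 < x -> ratioK v x = 2 * v + x ^+ 2 / ratioK (v - 1) x.
Proof.
move=> x0.
have H1 := GK_pos v x x0; have H2 := GK_pos (v - 1) x x0.
rewrite /ratioK subrK (GK_rec v); last exact: quarter_gt0.
move: H1 H2; move: (GK v _) (GK (v - 1) _) => a b a0 b0.
by field; rewrite !gt_eqF.
Qed.

Lemma besselIK_inv v x : 0 < x -> -1 <= v ->
  (besselI v x * besselK v x)^-1 = ratioK v x + x ^+ 2 / ratioI (v + 1) x.
Proof.
move=> x0 v1.
have H1 : 0 < besselH v (x ^+ 2 / 4) by rewrite besselH_gt0 ?quarter_gt0.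
have H2 : 0 < besselH (v + 1) (x ^+ 2 / 4)
  by rewrite besselH_gt0 ?quarter_gt0//; lra.
have H3 := GK_pos v x x0.
have P : besselI v x * besselK v x =
    besselH v (x ^+ 2 / 4) * GK v (x ^+ 2 / 4) / 2.
  rewrite besselIE// besselKE//.
  have : (x / 2) `^ v * (2 / x) `^ v = 1.
    rewrite -powRM ?divr_ge0 ?(ltW x0)//.
    have -> : x / 2 * (2 / x) = 1 by field; rewrite gt_eqF.
    by rewrite powR1.
  move: ((x / 2) `^ v) ((2 / x) `^ v) => a b ab.
  transitivity (a * b * (besselH v (x ^+ 2 / 4) * GK v (x ^+ 2 / 4) / 2)).
    by ring.
  by rewrite ab mul1r.
have := wronskianE v _ (quarter_gt0 x x0); rewrite /wronskian => W.
rewrite P /ratioK /ratioI addrK.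
move: W H1 H2 H3; move: (besselH v _) (besselH (v + 1) _) (GK v _) (GK (v + 1) _).
move=> a b c d W a0 b0 c0.
(* The bracket is the Wronskian, equal to 1. *)
transitivity (2 * (a * d + x ^+ 2 / 4 * b * c) / (a * c)).
  by rewrite W mulr1; field; rewrite !gt_eqF.
by field; rewrite !gt_eqF.
Qed.

End ratios.

(** * Bounds on single ratios *)

Section ratio_bounds.
Context {R : realType}.
Implicit Types v x a w m : R.

Lemma addr_gt0_sqr_lt a (s : R) : 0 < s -> a ^+ 2 < s ^+ 2 -> 0 < a + s.
Proof.
move=> s0; rewrite -subr_gt0 subr_sqr => h.
have [//|h1] := ltP 0 (a + s).
have : (s - a) * (s + a) <= 0 by rewrite mulr_ge0_le0//; lra.
lra.
Qed.

Lemma ltf_pdiv2l (c a b : R) : 0 < c -> 0 < a -> a < b -> c / b < c / a.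
Proof.
move=> c0 a0 ab; rewrite ltr_pM2l// ltf_pV2 ?posrE//; exact: lt_trans ab.
Qed.

Lemma lef_pdiv2l (c a b : R) : 0 < c -> 0 < a -> a <= b -> c / b <= c / a.
Proof.
by move=> c0 a0 ab; rewrite ler_pM2l// lef_pV2 ?posrE//; exact: lt_le_trans ab.
Qed.

Lemma sqrt_add_gt_norm a (c : R) : 0 < c -> `|a| < Num.sqrt (a ^+ 2 + c).
Proof.
move=> c0; rewrite -sqrtr_sqr ltr_sqrt; first by lra.
by have := sqr_ge0 a; lra.
Qed.

Lemma add_sqrt_gt0 a x : 0 < x -> 0 < a + Num.sqrt (a ^+ 2 + x ^+ 2).
Proof.
move=> x0; have x20 : 0 < x ^+ 2 by rewrite exprn_gt0.
by have := sqrt_add_gt_norm a _ x20;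
  have := ler_norm (- a); rewrite normrN; lra.
Qed.

(** Factors [x^2] as a difference of squares; this keeps the shape of a bound when the recurrence
    inverts it. *)
Lemma div_add_sqrt a x : 0 < x ->
  x ^+ 2 / (a + Num.sqrt (a ^+ 2 + x ^+ 2)) = Num.sqrt (a ^+ 2 + x ^+ 2) - a.
Proof.
move=> x0; have p := add_sqrt_gt0 a x x0.
have sq : Num.sqrt (a ^+ 2 + x ^+ 2) ^+ 2 = a ^+ 2 + x ^+ 2.
  by rewrite sqr_sqrtr// addr_ge0 ?sqr_ge0.
move: sq p; set s := Num.sqrt _ => sq p.
have -> : x ^+ 2 = s ^+ 2 - a ^+ 2 by rewrite sq; ring.
by field; rewrite gt_eqF.
Qed.

(* The radicands are related by sqrt (m^2 + (m/w) x^2) =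
   (m/w) sqrt (w^2 + (w/m) x^2). *)
Lemma div_add_sqrt_ratio w m x : 0 < x -> 0 < w -> 0 < m ->
  x ^+ 2 / (w + Num.sqrt (w ^+ 2 + w / m * x ^+ 2)) =
  Num.sqrt (m ^+ 2 + m / w * x ^+ 2) - m.
Proof.
move=> x0 w0 m0; have x20 : 0 < x ^+ 2 by rewrite exprn_gt0.
have r0 : 0 < w ^+ 2 + w / m * x ^+ 2.
  by rewrite addr_gt0 ?exprn_gt0// mulr_gt0// divr_gt0.
have -> : m ^+ 2 + m / w * x ^+ 2 = (m / w) ^+ 2 * (w ^+ 2 + w / m * x ^+ 2).
  by field; rewrite !gt_eqF.
rewrite sqrtrM ?sqr_ge0// sqrtr_sqr gtr0_norm ?divr_gt0//.
have sq := sqr_sqrtr (ltW r0).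
have s0 : 0 < Num.sqrt (w ^+ 2 + w / m * x ^+ 2) by rewrite sqrtr_gt0.
move: sq s0; set s := Num.sqrt _ => sq s0.
have -> : x ^+ 2 = (s ^+ 2 - w ^+ 2) * (m / w).
  by rewrite sq; field; rewrite !gt_eqF.
by field; rewrite !gt_eqF//=; lra.
Qed.

(** The choice [al = v], [D = v^2], [g = 1] makes [f] a root of [y + v f - f^2], so the defect is
    just [e y]. The same nullcline serves [ratioI_lt_sqrt] with [e = -1]. *)
Lemma ratioK_gt_sqrt v x : 0 < x -> v + Num.sqrt (v ^+ 2 + x ^+ 2) < ratioK v x.
Proof.
move=> x0; rewrite -[x ^+ 2]mul1r.
apply: ratioK_gt => // [|y s y0 s0 e]; first exact: sqr_ge0.
split; first by apply: addr_gt0_sqr_lt => //; lra.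
by rewrite (_ : riccati_defect _ _ _ _ _ _ _ = y)// /riccati_defect; ring.
Qed.

Lemma ratioI_lt_sqrt v x : 0 < x -> 0 <= v ->
  ratioI v x < v + Num.sqrt (v ^+ 2 + x ^+ 2).
Proof.
move=> x0 v0; rewrite -[x ^+ 2]mul1r.
apply: ratioI_lt => // [| | |y s y0 s0 e]; [lra|exact: sqr_ge0| |].
  by rewrite sqrtr_sqr ger0_norm//; lra.
split; first lra.
by rewrite (_ : riccati_defect _ _ _ _ _ _ _ = - y)
  ?oppr_lt0// /riccati_defect; ring.
Qed.

Lemma ratioK_le_sqrt_half v x : 0 < x -> - (1 / 2) <= v ->
  ratioK v x <= v + 1 / 2 + Num.sqrt ((v + 1 / 2) ^+ 2 + x ^+ 2).
Proof.
move=> x0 v0; rewrite -[x ^+ 2]mul1r.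
apply: ratioK_le => // [|y s y0 s0 e]; first exact: sqr_ge0.
split; first lra.
have -> : riccati_defect v (v + 1 / 2) ((v + 1 / 2) ^+ 2) 1 1 y s =
    - ((v + 1 / 2) * (s + (v + 1 / 2)) / 4).
  by rewrite /riccati_defect; field.
by rewrite oppr_le0 divr_ge0// mulr_ge0; lra.
Qed.

Lemma ratioI_gt_sqrt_half v x : 0 < x -> 1 / 2 <= v ->
  v - 1 / 2 + Num.sqrt ((v - 1 / 2) ^+ 2 + x ^+ 2) < ratioI v x.
Proof.
move=> x0; rewrite le_eqVlt => /predU1P[<-|v0].
  (* At [v = 1/2] the claim is [x < x coth x]; here [al = D = 0] and the defect is identically 0. *)
  rewrite subrr expr0n/= !add0r.
  have y0 : 0 < x ^+ 2 / 4 by rewrite divr_gt0// exprn_gt0.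
  rewrite ltr_pdivlMr; last by rewrite besselH_gt0//; lra.
  suff : (0 + Num.sqrt (0 + 1 * (4 * (x ^+ 2 / 4)))) / 2 *
      besselH (1 / 2) (x ^+ 2 / 4) < besselH (1 / 2 - 1) (x ^+ 2 / 4).
    rewrite !add0r mul1r (_ : 4 * (x ^+ 2 / 4) = x ^+ 2); last by field.
    lra.
  by apply: besselH_ratio_gt_crit => // y yp; field.
rewrite -[x ^+ 2]mul1r.
apply: ratioI_gt => // [| | |y s y0 s0 e]; [lra|exact: sqr_ge0| |].
  by rewrite sqrtr_sqr ger0_norm; lra.
split; first lra.
have -> : riccati_defect v (v - 1 / 2) ((v - 1 / 2) ^+ 2) 1 (-1) y s =
    (v - 1 / 2) * (s + (v - 1 / 2)) / 4.
  by rewrite /riccati_defect; field.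
by rewrite divr_gt0// mulr_gt0; lra.
Qed.

Let ratio_sqr_lt v (g y s : R) : 0 < g -> 0 < y ->
  s ^+ 2 = v ^+ 2 + g * (4 * y) ->
  v ^+ 2 < s ^+ 2.
Proof. by move=> g0 y0 ->; rewrite ltrDl !mulr_gt0. Qed.

(** The coefficient [v / (v + 1)] matches the expansion [h_v = 2 v + x^2 / (2 (v + 1)) + ...] at 0.
    In [ratioK_lt_sqrt_quot], [v / (v - 1)] plays the same part for [k_v]. *)
Lemma ratioI_gt_sqrt_quot v x : 0 < x -> 0 < v ->
  v + Num.sqrt (v ^+ 2 + v / (v + 1) * x ^+ 2) < ratioI v x.
Proof.
move=> x0 v0; have v1 : 0 < v + 1 by lra.
have g0 : 0 < v / (v + 1) by rewrite divr_gt0.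
apply: ratioI_gt => // [| | |y s y0 s0 e]; [lra|exact: sqr_ge0| |].
  by rewrite sqrtr_sqr ger0_norm; lra.
have vs : 0 < - v + s.
  by apply: addr_gt0_sqr_lt => //; rewrite sqrrN; exact: ratio_sqr_lt e.
split; first lra.
have -> : riccati_defect v v (v ^+ 2) (v / (v + 1)) (-1) y s =
    y * (- v + s) / (v + 1).
  by rewrite /riccati_defect; field; rewrite gt_eqF.
by rewrite divr_gt0// mulr_gt0.
Qed.

Lemma ratioK_lt_sqrt_quot v x : 0 < x -> 1 < v ->
  ratioK v x < v + Num.sqrt (v ^+ 2 + v / (v - 1) * x ^+ 2).
Proof.
move=> x0 v1; have v10 : 0 < v - 1 by lra.
have g0 : 0 < v / (v - 1) by rewrite divr_gt0//; lra.
apply: ratioK_lt => // [|y s y0 s0 e]; first exact: sqr_ge0.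
have vs : 0 < - v + s.
  by apply: addr_gt0_sqr_lt => //; rewrite sqrrN; exact: ratio_sqr_lt e.
split; first lra.
have -> : riccati_defect v v (v ^+ 2) (v / (v - 1)) 1 y s =
    - (y * (- v + s) / (v - 1)).
  by rewrite /riccati_defect; field; rewrite gt_eqF.
by rewrite oppr_lt0 divr_gt0// mulr_gt0.
Qed.

(** With [g = 1], [al = v - 1/2] kills the term in [y] and then [D = v^2 - 1/4] kills the term in
    [s], leaving the constant [D / 4]. For [K] the shift of [al] changes sign. *)
Lemma ratioI_gt_sqrt_quarter v x : 0 < x -> 1 / 2 < v ->
  v - 1 / 2 + Num.sqrt (v ^+ 2 - 1 / 4 + x ^+ 2) < ratioI v x.
Proof.
move=> x0 v0; rewrite -[x ^+ 2]mul1r.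
have D0 : 0 < v ^+ 2 - 1 / 4 by nra.
apply: ratioI_gt => // [| | |y s y0 s0 e]; [lra|exact: ltW| |].
  have : Num.sqrt (v ^+ 2 - 1 / 4) <= Num.sqrt (v ^+ 2)
    by rewrite ler_wsqrtr//; lra.
  by rewrite sqrtr_sqr ger0_norm; lra.
split; first lra.
have -> : riccati_defect v (v - 1 / 2) (v ^+ 2 - 1 / 4) 1 (-1) y s =
    (v ^+ 2 - 1 / 4) / 4.
  by rewrite /riccati_defect; field.
by rewrite divr_gt0.
Qed.

Lemma ratioK_le_sqrt_quarter v x : 0 < x -> 1 / 2 <= v ->
  ratioK v x <= v + 1 / 2 + Num.sqrt (v ^+ 2 - 1 / 4 + x ^+ 2).
Proof.
move=> x0 v0; rewrite -[x ^+ 2]mul1r.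
have D0 : 0 <= v ^+ 2 - 1 / 4 by nra.
apply: ratioK_le => // y s y0 s0 e.
split; first lra.
have -> : riccati_defect v (v + 1 / 2) (v ^+ 2 - 1 / 4) 1 1 y s =
    - ((v ^+ 2 - 1 / 4) / 4).
  by rewrite /riccati_defect; field.
by rewrite oppr_le0 divr_ge0.
Qed.

(** The recurrence is read backwards: a lower bound on [k_(v+1) = 2 (v + 1) + x^2 / k_v] bounds
    [k_v] from above. *)
Lemma ratioK_lt_sqrt_succ v x : 0 < x ->
  ratioK v x < v + 1 + Num.sqrt ((v + 1) ^+ 2 + x ^+ 2).
Proof.
move=> x0; have x20 : 0 < x ^+ 2 by rewrite exprn_gt0.
have h := ratioK_gt_sqrt (v + 1) x x0.
rewrite ratioK_rec// addrK in h.
have := div_add_sqrt (v + 1) x x0 => e.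
have k0 := ratioK_gt0 v x x0; have p := add_sqrt_gt0 (v + 1) x x0.
rewrite ltNge; apply/negP => /(lef_pdiv2l _ _ _ x20 p); lra.
Qed.

Lemma ratioK_lt_sqrt_pred v x : 0 < x ->
  ratioK v x < v + 1 + Num.sqrt ((v - 1) ^+ 2 + x ^+ 2).
Proof.
move=> x0; have x20 : 0 < x ^+ 2 by rewrite exprn_gt0.
have h := ratioK_gt_sqrt (v - 1) x x0; have p := add_sqrt_gt0 (v - 1) x x0.
have := ltf_pdiv2l _ _ _ x20 p h; rewrite div_add_sqrt// (ratioK_rec v)//; lra.
Qed.

Lemma ratioI_gt_sqrt_succ v x : 0 < x -> -1 <= v ->
  v - 1 + Num.sqrt ((v + 1) ^+ 2 + x ^+ 2) < ratioI v x.
Proof.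
move=> x0 v1; have x20 : 0 < x ^+ 2 by rewrite exprn_gt0.
have v10 : 0 <= v + 1 by lra.
have h := ratioI_lt_sqrt (v + 1) x x0 v10.
have p := ratioI_gt0 (v + 1) x x0 v10.
have := ltf_pdiv2l _ _ _ x20 p h; rewrite div_add_sqrt// (ratioI_rec v)//; lra.
Qed.

Lemma ratioK_ge_sqrt_half v x : 0 < x -> 1 / 2 <= v ->
  v + 1 / 2 + Num.sqrt ((v - 1 / 2) ^+ 2 + x ^+ 2) <= ratioK v x.
Proof.
move=> x0 v0; have x20 : 0 < x ^+ 2 by rewrite exprn_gt0.
have v1 : - (1 / 2) <= v - 1 by lra.
have h := ratioK_le_sqrt_half (v - 1) x x0 v1.
have p := ratioK_gt0 (v - 1) x x0.
have := lef_pdiv2l _ _ _ x20 p h; rewrite div_add_sqrt// (ratioK_rec v)//.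
have -> : v - 1 + 1 / 2 = v - 1 / 2 by field.
lra.
Qed.

Lemma ratioI_lt_sqrt_half v x : 0 < x -> - (1 / 2) <= v ->
  ratioI v x < v - 1 / 2 + Num.sqrt ((v + 1 / 2) ^+ 2 + x ^+ 2).
Proof.
move=> x0 v0; have x20 : 0 < x ^+ 2 by rewrite exprn_gt0.
have v1 : 1 / 2 <= v + 1 by lra.
have h := ratioI_gt_sqrt_half (v + 1) x x0 v1.
have p := add_sqrt_gt0 (v + 1 - 1 / 2) x x0.
have := ltf_pdiv2l _ _ _ x20 p h; rewrite div_add_sqrt// (ratioI_rec v)//;
  last lra.
have -> : v + 1 - 1 / 2 = v + 1 / 2 by field.
lra.
Qed.

Lemma ratioK_gt_sqrt_quot v x : 0 < x -> 2 <= v ->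
  v + 2 + Num.sqrt ((v - 2) ^+ 2 + (v - 2) / (v - 1) * x ^+ 2) < ratioK v x.
Proof.
move=> x0; have x20 : 0 < x ^+ 2 by rewrite exprn_gt0.
rewrite le_eqVlt => /predU1P[<-|v2].
  (* At [v = 2] the square root vanishes and the bound is [2 v], which the recurrence exceeds by a
     positive term. *)
  rewrite subrr mul0r mul0r expr0n/= addr0 sqrtr0 addr0 ratioK_rec//.
  have : 0 < x ^+ 2 / ratioK (2 - 1) x by rewrite divr_gt0// ratioK_gt0.
  lra.
have v1 : 1 < v - 1 by lra.
have h := ratioK_lt_sqrt_quot (v - 1) x x0 v1.
have p := ratioK_gt0 (v - 1) x x0.
have := ltf_pdiv2l _ _ _ x20 p h; rewrite (ratioK_rec v)//.
have -> : v - 1 - 1 = v - 2 by ring.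
by rewrite div_add_sqrt_ratio//; lra.
Qed.

Lemma ratioI_lt_sqrt_quot v x : 0 < x -> -1 < v ->
  ratioI v x < v - 2 + Num.sqrt ((v + 2) ^+ 2 + (v + 2) / (v + 1) * x ^+ 2).
Proof.
move=> x0 v1; have x20 : 0 < x ^+ 2 by rewrite exprn_gt0.
have v10 : 0 < v + 1 by lra.
have h := ratioI_gt_sqrt_quot (v + 1) x x0 v10.
have p : 0 < v + 1 + Num.sqrt ((v + 1) ^+ 2 + (v + 1) / (v + 1 + 1) * x ^+ 2).
  by rewrite ltr_pwDl// sqrtr_ge0.
have := ltf_pdiv2l _ _ _ x20 p h; rewrite (ratioI_rec v)//; last lra.
have -> : v + 1 + 1 = v + 2 by ring.
by rewrite div_add_sqrt_ratio//; lra.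
Qed.

End ratio_bounds.

(** * Bounds on the reciprocal of the product *)

Section product_bounds.
Context {R : realType}.
Implicit Types v nu x a b d : R.

Lemma besselIK_inv_swap v x : 0 < x -> -1 <= v ->
  (besselI v x * besselK v x)^-1 = ratioI v x + x ^+ 2 / ratioK (v - 1) x.
Proof.
by move=> x0 v1; rewrite besselIK_inv// (ratioI_rec v)// (ratioK_rec v)//; ring.
Qed.

Lemma besselIK_inv_sum v x : 0 < x -> -1 <= v ->
  (besselI v x * besselK v x)^-1 = ratioI v x + ratioK v x - 2 * v.
Proof.
by move=> x0 v1; rewrite besselIK_inv// (ratioI_rec v)//; ring.
Qed.

Lemma besselIK_gt0 v x : 0 < x -> -1 <= v -> 0 < besselI v x * besselK v x.
Proof.
move=> x0 v1; rewrite -invr_gt0 besselIK_inv//.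
have v10 : 0 <= v + 1 by lra.
apply: addr_gt0; first exact: ratioK_gt0.
by apply: divr_gt0; [exact: exprn_gt0|exact: ratioI_gt0].
Qed.

Lemma inv_EFin_lt a d : 0 < a -> a^-1 < d -> (d%:E^-1 < a%:E)%E.
Proof.
move=> a0 ad; have d0 : 0 < d by apply: lt_trans ad; rewrite invr_gt0.
by rewrite inver gt_eqF// lte_fin invf_plt ?posrE.
Qed.

(** At [d = 0] the inverse is [+oo], so only weak nonnegativity of the denominators has to be
    checked. *)
Lemma lt_inv_EFin a d : 0 < a -> 0 <= d -> d < a^-1 -> (a%:E < d%:E^-1)%E.
Proof.
move=> a0; rewrite le_eqVlt => /predU1P[<- _|d0 ad];
  first by rewrite inve0 ltry.
by rewrite inver gt_eqF// lte_fin invf_pgt ?posrE.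
Qed.

Lemma esqrt_ratioE a b x : b != 0 ->
  esqrt_ratio a b x = (Num.sqrt (a ^+ 2 + a / b * x ^+ 2))%:E.
Proof. by move=> b0; rewrite /esqrt_ratio inver (negPf b0). Qed.

Lemma esqrt_ratio_y a x : 0 < a -> 0 < x -> esqrt_ratio a 0 x = +oo%E.
Proof.
move=> a0 x0; rewrite /esqrt_ratio inve0 gt0_muley ?lte_fin//.
by rewrite gt0_mulye ?lte_fin ?exprn_gt0.
Qed.

Lemma sqrt_add_sqrt_ge1 a x : 0 < x ->
  0 <= Num.sqrt (a ^+ 2 + x ^+ 2) + Num.sqrt ((a + 1) ^+ 2 + x ^+ 2) - 1.
Proof.
move=> x0; have x20 : 0 < x ^+ 2 by rewrite exprn_gt0.
have := sqrt_add_gt_norm a _ x20; have := sqrt_add_gt_norm (a + 1) _ x20.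
by have := ler_norm (a + 1); have := ler_norm (- a); rewrite normrN; lra.
Qed.

Lemma bound11_upper nu x : 0 < x -> -1 <= nu ->
  Num.sqrt (nu ^+ 2 + x ^+ 2) + Num.sqrt ((nu + 1) ^+ 2 + x ^+ 2) - 1 <
  (besselI nu x * besselK nu x)^-1.
Proof.
move=> x0 v1; rewrite besselIK_inv//.
have x20 : 0 < x ^+ 2 by rewrite exprn_gt0.
have v10 : 0 <= nu + 1 by lra.
have h1 := ratioK_gt_sqrt nu x x0; have h2 := ratioI_lt_sqrt (nu + 1) x x0 v10.
have := ltf_pdiv2l _ _ _ x20 (ratioI_gt0 _ _ x0 v10) h2.
by rewrite div_add_sqrt//; lra.
Qed.

Lemma bound11_lower nu x : 0 < x -> 0 <= nu ->
  (besselI nu x * besselK nu x)^-1 <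
  Num.sqrt (nu ^+ 2 + x ^+ 2) + Num.sqrt ((nu - 1) ^+ 2 + x ^+ 2) + 1.
Proof.
move=> x0 v0; rewrite besselIK_inv_swap//; last lra.
have x20 : 0 < x ^+ 2 by rewrite exprn_gt0.
have h1 := ratioI_lt_sqrt nu x x0 v0; have h2 := ratioK_gt_sqrt (nu - 1) x x0.
have := ltf_pdiv2l _ _ _ x20 (add_sqrt_gt0 _ _ x0) h2.
by rewrite div_add_sqrt//; lra.
Qed.

(** Weaker than the (1,1) bound, because [|nu - 1| <= nu + 1] for [nu >= 0]. *)
Lemma bound01_upper nu x : 0 < x -> 0 <= nu ->
  Num.sqrt (nu ^+ 2 + x ^+ 2) + Num.sqrt ((nu - 1) ^+ 2 + x ^+ 2) - 1 <
  (besselI nu x * besselK nu x)^-1.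
Proof.
move=> x0 v0; have v1 : -1 <= nu by lra.
apply: le_lt_trans (bound11_upper nu x x0 v1).
rewrite lerD2r lerD2l ler_wsqrtr// lerD2r; nra.
Qed.

Lemma bound01_lower nu x : 0 < x -> -1 <= nu ->
  (besselI nu x * besselK nu x)^-1 <
  Num.sqrt (nu ^+ 2 + x ^+ 2) + Num.sqrt ((nu + 1) ^+ 2 + x ^+ 2) + 1.
Proof.
move=> x0 v1; rewrite besselIK_inv//.
have x20 : 0 < x ^+ 2 by rewrite exprn_gt0.
have v11 : -1 <= nu + 1 by lra.
have h1 := ratioK_lt_sqrt_succ nu x x0.
have h2 := ratioI_gt_sqrt_succ (nu + 1) x x0 v11.
(* Weakens [nu + 2] to [nu] under the root, using [|nu| <= nu + 2], so that [div_add_sqrt]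
   applies. *)
have h3 : nu + Num.sqrt (nu ^+ 2 + x ^+ 2) < ratioI (nu + 1) x.
  apply: le_lt_trans h2; rewrite addrK lerD2l ler_wsqrtr// lerD2r; nra.
have := ltf_pdiv2l _ _ _ x20 (add_sqrt_gt0 _ _ x0) h3.
by rewrite div_add_sqrt//; lra.
Qed.

Lemma bound02_upper nu x : 0 < x -> 1 / 2 <= nu ->
  2 * Num.sqrt ((nu - 1 / 2) ^+ 2 + x ^+ 2) < (besselI nu x * besselK nu x)^-1.
Proof.
move=> x0 v0; rewrite besselIK_inv_swap//; last lra.
have x20 : 0 < x ^+ 2 by rewrite exprn_gt0.
have v1 : - (1 / 2) <= nu - 1 by lra.
have h1 := ratioI_gt_sqrt_half nu x x0 v0.
have h2 := ratioK_le_sqrt_half (nu - 1) x x0 v1.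
have := lef_pdiv2l _ _ _ x20 (ratioK_gt0 _ _ x0) h2.
rewrite div_add_sqrt//.
have -> : nu - 1 + 1 / 2 = nu - 1 / 2 by field.
lra.
Qed.

Lemma bound02_lower nu x : 0 < x -> - (1 / 2) <= nu ->
  (besselI nu x * besselK nu x)^-1 < 2 * Num.sqrt ((nu + 1 / 2) ^+ 2 + x ^+ 2).
Proof.
move=> x0 v0; rewrite besselIK_inv//; last lra.
have x20 : 0 < x ^+ 2 by rewrite exprn_gt0.
have v1 : 1 / 2 <= nu + 1 by lra.
have h1 := ratioK_le_sqrt_half nu x x0 v0.
have h2 := ratioI_gt_sqrt_half (nu + 1) x x0 v1.
have := ltf_pdiv2l _ _ _ x20 (add_sqrt_gt0 _ _ x0) h2.
rewrite div_add_sqrt//.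
have -> : nu + 1 - 1 / 2 = nu + 1 / 2 by field.
lra.
Qed.

Lemma bound12_upper nu x : 0 < x -> 1 / 2 <= nu ->
  nu + 1 / 2 + Num.sqrt ((nu - 1 / 2) ^+ 2 + x ^+ 2)
  + x ^+ 2 / (nu + 1 / 2 + Num.sqrt ((nu + 3 / 2) ^+ 2 + x ^+ 2))
  < (besselI nu x * besselK nu x)^-1.
Proof.
move=> x0 v0; rewrite besselIK_inv//; last lra.
have x20 : 0 < x ^+ 2 by rewrite exprn_gt0.
have v1 : - (1 / 2) <= nu + 1 by lra.
have v2 : 0 <= nu + 1 by lra.
have h1 := ratioK_ge_sqrt_half nu x x0 v0.
have h2 := ratioI_lt_sqrt_half (nu + 1) x x0 v1.
have := ltf_pdiv2l _ _ _ x20 (ratioI_gt0 _ _ x0 v2) h2.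
have -> : nu + 1 - 1 / 2 = nu + 1 / 2 by field.
have -> : nu + 1 + 1 / 2 = nu + 3 / 2 by field.
lra.
Qed.

Lemma bound12_lower nu x : 0 < x -> 3 / 2 <= nu ->
  (besselI nu x * besselK nu x)^-1 <
  nu - 1 / 2 + Num.sqrt ((nu + 1 / 2) ^+ 2 + x ^+ 2)
  + x ^+ 2 / (nu - 1 / 2 + Num.sqrt ((nu - 3 / 2) ^+ 2 + x ^+ 2)).
Proof.
move=> x0 v0; rewrite besselIK_inv_swap//; last lra.
have x20 : 0 < x ^+ 2 by rewrite exprn_gt0.
have v1 : - (1 / 2) <= nu by lra.
have v2 : 1 / 2 <= nu - 1 by lra.
have h1 := ratioI_lt_sqrt_half nu x x0 v1.
have h2 := ratioK_ge_sqrt_half (nu - 1) x x0 v2.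
have p : 0 < nu - 1 + 1 / 2 + Num.sqrt ((nu - 1 - 1 / 2) ^+ 2 + x ^+ 2).
  by rewrite ltr_pwDl ?sqrtr_ge0//; lra.
have := lef_pdiv2l _ _ _ x20 p h2.
have -> : nu - 1 + 1 / 2 = nu - 1 / 2 by field.
have -> : nu - 1 - 1 / 2 = nu - 3 / 2 by field.
lra.
Qed.

Lemma bound21_upper nu x : 0 < x -> 0 <= nu ->
  nu - 1 + Num.sqrt ((nu + 1) ^+ 2 + x ^+ 2)
  + x ^+ 2 / (nu + Num.sqrt ((nu - 2) ^+ 2 + x ^+ 2))
  < (besselI nu x * besselK nu x)^-1.
Proof.
move=> x0 v0; have v1 : -1 <= nu by lra.
rewrite besselIK_inv_swap//.
have x20 : 0 < x ^+ 2 by rewrite exprn_gt0.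
have h1 := ratioI_gt_sqrt_succ nu x x0 v1.
have h2 := ratioK_lt_sqrt_pred (nu - 1) x x0.
have := ltf_pdiv2l _ _ _ x20 (ratioK_gt0 _ _ x0) h2.
rewrite subrK; have -> : nu - 1 - 1 = nu - 2 by ring.
lra.
Qed.

Lemma bound21_lower nu x : 0 < x -> -1 <= nu ->
  (besselI nu x * besselK nu x)^-1 <
  nu + 1 + Num.sqrt ((nu - 1) ^+ 2 + x ^+ 2)
  + x ^+ 2 / (nu + Num.sqrt ((nu + 2) ^+ 2 + x ^+ 2)).
Proof.
move=> x0 v1; rewrite besselIK_inv//.
have x20 : 0 < x ^+ 2 by rewrite exprn_gt0.
have v11 : -1 <= nu + 1 by lra.
have h1 := ratioK_lt_sqrt_pred nu x x0.
have h2 := ratioI_gt_sqrt_succ (nu + 1) x x0 v11.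
rewrite addrK in h2.
have e : nu + 1 + 1 = nu + 2 by ring.
rewrite e in h2.
(* [nu] may be negative here; [|nu| <= nu + 2] gives the sign. *)
have p : 0 < nu + Num.sqrt ((nu + 2) ^+ 2 + x ^+ 2).
  apply: lt_le_trans (add_sqrt_gt0 nu x x0) _.
  rewrite lerD2l ler_wsqrtr// lerD2r; nra.
have := ltf_pdiv2l _ _ _ x20 p h2; lra.
Qed.

Lemma bound10_upper nu x : 0 < x -> 0 < nu ->
  2 * Num.sqrt (nu ^+ 2 + nu / (nu + 1) * x ^+ 2) <
  (besselI nu x * besselK nu x)^-1.
Proof.
move=> x0 v0; rewrite besselIK_inv_sum//; last lra.
have x20 : 0 < x ^+ 2 by rewrite exprn_gt0.
have h1 := ratioI_gt_sqrt_quot nu x x0 v0; have h2 := ratioK_gt_sqrt nu x x0.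
(* The linear parts of the two ratio bounds cancel [2 nu]; the larger root is lowered to the smaller
   one to reach twice a single root. *)
have : Num.sqrt (nu ^+ 2 + nu / (nu + 1) * x ^+ 2)
  <= Num.sqrt (nu ^+ 2 + x ^+ 2).
  rewrite ler_wsqrtr// lerD2l ler_piMl ?(ltW x20)// ler_pdivrMr; lra.
lra.
Qed.

Lemma bound10_lower nu x : 0 < x -> 1 < nu ->
  (besselI nu x * besselK nu x)^-1 <
  2 * Num.sqrt (nu ^+ 2 + nu / (nu - 1) * x ^+ 2).
Proof.
move=> x0 v1; have v0 : 0 <= nu by lra.
rewrite besselIK_inv_sum//; last lra.
have x20 : 0 < x ^+ 2 by rewrite exprn_gt0.
have h1 := ratioI_lt_sqrt nu x x0 v0; have h2 := ratioK_lt_sqrt_quot nu x x0 v1.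
have : Num.sqrt (nu ^+ 2 + x ^+ 2)
  <= Num.sqrt (nu ^+ 2 + nu / (nu - 1) * x ^+ 2).
  rewrite ler_wsqrtr// lerD2l ler_peMl ?(ltW x20)// ler_pdivlMr; lra.
lra.
Qed.

Lemma bound20_upper nu x : 0 < x -> 2 <= nu ->
  Num.sqrt ((nu - 2) ^+ 2 + (nu - 2) / (nu - 1) * x ^+ 2)
  + Num.sqrt (nu ^+ 2 + nu / (nu + 1) * x ^+ 2) + 2 <
  (besselI nu x * besselK nu x)^-1.
Proof.
move=> x0 v2; have v0 : 0 < nu by lra.
rewrite besselIK_inv_sum//; last lra.
have h1 := ratioI_gt_sqrt_quot nu x x0 v0.
have h2 := ratioK_gt_sqrt_quot nu x x0 v2.
lra.
Qed.

Lemma bound20_lower nu x : 0 < x -> 1 < nu ->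
  (besselI nu x * besselK nu x)^-1 <
  Num.sqrt ((nu + 2) ^+ 2 + (nu + 2) / (nu + 1) * x ^+ 2)
  + Num.sqrt (nu ^+ 2 + nu / (nu - 1) * x ^+ 2) - 2.
Proof.
move=> x0 v1; have v0 : -1 < nu by lra.
rewrite besselIK_inv_sum//; last lra.
have h1 := ratioI_lt_sqrt_quot nu x x0 v0.
have h2 := ratioK_lt_sqrt_quot nu x x0 v1.
lra.
Qed.

Lemma bound30_upper nu x : 0 < x -> 2 <= nu ->
  nu + 2 + Num.sqrt ((nu - 2) ^+ 2 + (nu - 2) / (nu - 1) * x ^+ 2)
  + x ^+ 2 / (nu + 1 + Num.sqrt ((nu + 3) ^+ 2 + (nu + 3) / (nu + 2) * x ^+ 2))
  < (besselI nu x * besselK nu x)^-1.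
Proof.
move=> x0 v2; rewrite besselIK_inv//; last lra.
have x20 : 0 < x ^+ 2 by rewrite exprn_gt0.
have v1 : -1 < nu + 1 by lra.
have v10 : 0 <= nu + 1 by lra.
have h1 := ratioK_gt_sqrt_quot nu x x0 v2.
have h2 := ratioI_lt_sqrt_quot (nu + 1) x x0 v1.
have e1 : nu + 1 + 2 = nu + 3 by ring.
have e2 : nu + 1 + 1 = nu + 2 by ring.
rewrite e1 e2 in h2.
(* The offset obtained is [nu - 1]; it is relaxed by 2 to the one in the statement. *)
have h3 : ratioI (nu + 1) x <
    nu + 1 + Num.sqrt ((nu + 3) ^+ 2 + (nu + 3) / (nu + 2) * x ^+ 2) by lra.
have := ltf_pdiv2l _ _ _ x20 (ratioI_gt0 _ _ x0 v10) h3.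
lra.
Qed.

Lemma bound30_lower nu x : 0 < x -> 3 <= nu ->
  (besselI nu x * besselK nu x)^-1 <
  nu - 2 + Num.sqrt ((nu + 2) ^+ 2 + (nu + 2) / (nu + 1) * x ^+ 2)
  + x ^+ 2 / (nu - 1 + Num.sqrt ((nu - 3) ^+ 2 + (nu - 3) / (nu - 2) * x ^+ 2)).
Proof.
move=> x0 v3; rewrite besselIK_inv_swap//; last lra.
have x20 : 0 < x ^+ 2 by rewrite exprn_gt0.
have v1 : -1 < nu by lra.
have v2 : 2 <= nu - 1 by lra.
have h1 := ratioI_lt_sqrt_quot nu x x0 v1.
have h2 := ratioK_gt_sqrt_quot (nu - 1) x x0 v2.
have e1 : nu - 1 - 2 = nu - 3 by ring.
have e2 : nu - 1 - 1 = nu - 2 by ring.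
rewrite e1 e2 in h2.
(* The offset obtained is [nu + 1], again relaxed by 2. *)
have h3 : nu - 1 + Num.sqrt ((nu - 3) ^+ 2 + (nu - 3) / (nu - 2) * x ^+ 2) <
    ratioK (nu - 1) x by lra.
have p : 0 < nu - 1 + Num.sqrt ((nu - 3) ^+ 2 + (nu - 3) / (nu - 2) * x ^+ 2).
  by rewrite ltr_pwDl ?sqrtr_ge0//; lra.
have := ltf_pdiv2l _ _ _ x20 p h3.
lra.
Qed.

Lemma bound03_upper nu x : 0 < x -> 3 / 2 <= nu ->
  nu - 1 / 2 + Num.sqrt (nu ^+ 2 - 1 / 4 + x ^+ 2)
  + x ^+ 2 / (nu - 1 / 2 + Num.sqrt ((nu - 1) ^+ 2 - 1 / 4 + x ^+ 2))
  < (besselI nu x * besselK nu x)^-1.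
Proof.
move=> x0 v0; rewrite besselIK_inv_swap//; last lra.
have x20 : 0 < x ^+ 2 by rewrite exprn_gt0.
have v1 : 1 / 2 < nu by lra.
have v2 : 1 / 2 <= nu - 1 by lra.
have h1 := ratioI_gt_sqrt_quarter nu x x0 v1.
have h2 := ratioK_le_sqrt_quarter (nu - 1) x x0 v2.
have e : nu - 1 + 1 / 2 = nu - 1 / 2 by field.
rewrite e in h2.
have := lef_pdiv2l _ _ _ x20 (ratioK_gt0 _ _ x0) h2.
lra.
Qed.

Lemma bound03_lower nu x : 0 < x -> 1 / 2 <= nu ->
  (besselI nu x * besselK nu x)^-1 <
  nu + 1 / 2 + Num.sqrt (nu ^+ 2 - 1 / 4 + x ^+ 2)
  + x ^+ 2 / (nu + 1 / 2 + Num.sqrt ((nu + 1) ^+ 2 - 1 / 4 + x ^+ 2)).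
Proof.
move=> x0 v0; rewrite besselIK_inv//; last lra.
have x20 : 0 < x ^+ 2 by rewrite exprn_gt0.
have v1 : 1 / 2 < nu + 1 by lra.
have h1 := ratioK_le_sqrt_quarter nu x x0 v0.
have h2 := ratioI_gt_sqrt_quarter (nu + 1) x x0 v1.
have e : nu + 1 - 1 / 2 = nu + 1 / 2 by field.
rewrite e in h2.
have p : 0 < nu + 1 / 2 + Num.sqrt ((nu + 1) ^+ 2 - 1 / 4 + x ^+ 2).
  by rewrite ltr_pwDl ?sqrtr_ge0//; lra.
have := ltf_pdiv2l _ _ _ x20 p h2.
lra.
Qed.

End product_bounds.

Theorem theorem1 (R : realType) (pq : bound_label) (nu x : R) :
  0 < x ->
  (nuL pq <= nu ->
     (boundF pq (- 1) nu x < (besselI nu x * besselK nu x)%:E)%E) /\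
  (nuU pq <= nu ->
     ((besselI nu x * besselK nu x)%:E < boundF pq 1 nu x)%E).
Proof.
move=> x0.
have pos v1 := @besselIK_gt0 R nu x x0 v1.
have x20 : 0 < x ^+ 2 by rewrite exprn_gt0.
have sq (a : R) : 0 <= Num.sqrt a by exact: sqrtr_ge0.
have dv (a : R) : 0 <= a -> 0 <= x ^+ 2 / a.
  by move=> a0; rewrite divr_ge0// ltW.
rewrite /boundF; case: pq; rewrite /nuL /nuU /denF; split=> h;
  rewrite ?opprK ?mulrN1 ?mulr1 ?mulrN ?mulNr ?opprK.
- by apply: inv_EFin_lt; [apply: pos|apply: bound01_lower].
- apply: lt_inv_EFin; [by apply: pos; lra| |exact: bound01_upper].
  have := sqrt_add_sqrt_ge1 (nu - 1) x x0; rewrite subrK; lra.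
(* At [nu = 1] the denominator is [+oo] and the lower bound is 0, so positivity of the product
   suffices. *)
- move: h; rewrite le_eqVlt => /predU1P[<-|h].
    rewrite subrr esqrt_ratio_y// gt0_muley; last by rewrite lte_fin.
    rewrite invey lte_fin.
    by apply: besselIK_gt0 => //; lra.
  rewrite esqrt_ratioE ?gt_eqF ?subr_gt0// -EFinM.
  by apply: inv_EFin_lt; [apply: pos; lra|exact: bound10_lower].
- have n10 : 0 < nu + 1 by lra.
  rewrite esqrt_ratioE ?gt_eqF// -EFinM.
  (* At [nu = 0] the denominator is 0 and the upper bound is [+oo]. *)
  move: h; rewrite le_eqVlt => /predU1P[<-|h].
    by rewrite !mul0r expr0n/= addr0 sqrtr0 mulr0 inve0 ltry.
  apply: lt_inv_EFin; [by apply: pos; lra| |exact: bound10_upper].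
  by rewrite mulr_ge0.
- by apply: inv_EFin_lt; [apply: pos; lra|exact: bound02_lower].
- apply: lt_inv_EFin; [by apply: pos; lra| |exact: bound02_upper].
  by rewrite mulr_ge0.
- by apply: inv_EFin_lt; [apply: pos; lra|exact: bound11_lower].
- apply: lt_inv_EFin; [by apply: pos; lra| |exact: bound11_upper].
  exact: sqrt_add_sqrt_ge1.
- have n10 : 0 < nu + 1 by lra.
  rewrite esqrt_ratioE ?gt_eqF//.
  (* At [nu = 1] the second root is [+oo], which makes the lower bound 0 once more. *)
  move: h; rewrite le_eqVlt => /predU1P[<-|h].
    rewrite subrr esqrt_ratio_y// invey lte_fin.
    by apply: besselIK_gt0 => //; lra.
  rewrite esqrt_ratioE ?gt_eqF ?subr_gt0// -!EFinD.
  by apply: inv_EFin_lt; [apply: pos; lra|exact: bound20_lower].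
- rewrite !esqrt_ratioE; [|by rewrite gt_eqF//; lra|by rewrite gt_eqF//; lra].
  rewrite -!EFinD.
  apply: lt_inv_EFin; [by apply: pos; lra| |exact: bound20_upper].
  by rewrite !addr_ge0.
- by apply: inv_EFin_lt; [apply: pos; lra|exact: bound12_lower].
- apply: lt_inv_EFin; [by apply: pos; lra| |exact: bound12_upper].
  have h0 : 0 <= nu + 1 / 2 by lra.
  by apply: addr_ge0; [apply: addr_ge0|apply/dv/addr_ge0].
- by apply: inv_EFin_lt; [apply: pos; lra|exact: bound21_lower].
- apply: lt_inv_EFin; [by apply: pos; lra| |exact: bound21_upper].
  have := sqrt_add_gt_norm (nu + 1) _ x20; have := ler_norm (nu + 1) => h1 h2.
  by apply: addr_ge0; [lra|apply/dv/addr_ge0].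
- by apply: inv_EFin_lt; [apply: pos; lra|exact: bound30_lower].
- apply: lt_inv_EFin; [by apply: pos; lra| |exact: bound30_upper].
  have h0 : 0 <= nu + 2 by lra.
  have h1 : 0 <= nu + 1 by lra.
  by apply: addr_ge0; [apply: addr_ge0|apply/dv/addr_ge0].
- by apply: inv_EFin_lt; [apply: pos; lra|exact: bound03_lower].
- apply: lt_inv_EFin; [by apply: pos; lra| |exact: bound03_upper].
  have h0 : 0 <= nu - 1 / 2 by lra.
  by apply: addr_ge0; [apply: addr_ge0|apply/dv/addr_ge0].
Qed.
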